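(* For any $n\in\mathbb{N}$, the $n$-th dwrithe $\nabla J_n(D)$ of oriented virtual knot diagrams $D$ is a flat virtual knot invariant; that is, $\nabla J_n$ is an invariant of oriented virtual knots, and if $D'$ is obtained from $D$ by a crossing change at a classical crossing, then $\nabla J_n(D')=\nabla J_n(D)$.
   Context: $\mathbb{N}$ denotes the positive integers. A virtual knot diagram is a one-component planar knot diagram whose double points are either classical crossings (with over/under information) or virtual crossings. An oriented virtual knot is an equivalence class of oriented virtual knot diagrams under planar isotopy, the classical Reidemeister moves RI, RII, RIII, the virtual Reidemeister moves VRI, VRII, VRIII (the same moves with all crossings virtual), and the semi-virtual move SV (an arc with two consecutive virtual crossings is moved past a classical crossing). $C(D)$ is the set of classical crossings of $D$. A crossing change at a classical crossing switches over and under there. A virtual knot invariant is called a flat virtual knot invariant if it is independent of the crossing change operation. Sign: draw a classical crossing $c$ with both strands oriented upward. Then $\operatorname{sgn}(c)=+1$ if the over-strand goes from bottom left to top right, and $\operatorname{sgn}(c)=-1$ if the over-strand goes from bottom right to top left. Index: an arc is an edge of $D$ between two consecutive classical crossings along the orientation. Label all arcs by integers so that labels are unchanged at virtual crossings and, at each classical crossing drawn with both strands oriented upward (whatever its sign), if the incoming arc on the left (bottom left) has label $a$ and the incoming arc on the right (bottom right) has label $b$, then the outgoing arc at top left has label $b+1$ and the outgoing arc at top right has label $a-1$. Such a labeling always exists: for example, label an arc $\alpha$ by $\lambda(\alpha)=\sum_{c\in O(\alpha)}\operatorname{sgn}(c)$, where $O(\alpha)$ is the set of classical crossings first met as overcrossings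 when traveling along the orientation starting from $\alpha$. Then $\operatorname{Ind}(c)=\operatorname{sgn}(c)(a-b-1)$. Dwrithe: for $n\in\mathbb{Z}\setminus\{0\}$, the $n$-th writhe is $J_n(D)=\sum_{c\in C(D),\,\operatorname{Ind}(c)=n}\operatorname{sgn}(c)$. For $n\in\mathbb{N}$ the $n$-th dwrithe is $\nabla J_n(D)=J_n(D)-J_{-n}(D)$. *)

(* Defs.v *)
(* MathComp / MathComp-Analysis. *)
From Stdlib Require Import Relation_Operators.
From mathcomp Require Import all_boot all_order all_algebra.
From mathcomp Require Import all_classical all_reals all_analysis.

Set Implicit Arguments.
Unset Strict Implicit.
Unset Printing Implicit Defensive.

Import Order.TTheory GRing.Theory Num.Theory.
Import numFieldNormedType.Exports.

Local Open Scope classical_set_scope.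
Local Open Scope ring_scope.

(* Diagrams are genuine plane curves: generic 1-periodic C^1 immersions of the
   line in the plane R * R, each passage through a double point being marked
   over, under or virtual.  Parameters live on the circle R / Z. *)

Inductive passage := Over | Under | Virt.

Definition opp_passage (p : passage) : passage :=
  match p with Over => Under | Under => Over | Virt => Virt end.

Definition det2 {R : realType} (u v : R * R) : R := u.1 * v.2 - u.2 * v.1.

(* Two different points of the circle R / Z with the same image. *)
Definition meets {R : realType} (g : R -> R * R) (s t : R) : Prop :=
  g s = g t /\ s - t \isn't a Num.int.

Record vdiagram (R : realType) := VDiagram {
  curve : R -> R * R;
  pass : R -> passage;
  curve_periodic : forall t, curve (t + 1) = curve t;
  curve_derivable : forall t, derivable curve t 1;
  curve_C1 : continuous (curve^`()%classic : R -> R * R);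
  curve_immersion : forall t, curve^`()%classic t != 0;
  curve_transversal : forall s t, meets curve s t ->
    det2 (curve^`()%classic s) (curve^`()%classic t) != 0;
  curve_no_triple : forall s t u,
    meets curve s t -> meets curve s u -> t - u \is a Num.int;
  curve_finite : finite_set [set c : R * R |
    [/\ 0 <= c.1 < 1, 0 <= c.2 < 1 & meets curve c.1 c.2]];
  pass_periodic : forall t, pass (t + 1) = pass t;
  pass_opp : forall s t, meets curve s t -> pass t = opp_passage (pass s)
}.

Section Diagrams.
Variable R : realType.
Implicit Types (D E : vdiagram R) (c : R * R) (s t u : R).

Definition vel D t : R * R := (curve D)^`()%classic t.

(* The values of [pass D] are meaningful at these parameters only. *)
Definition double_param D t : Prop := exists u, meets (curve D) t u.

Definition classical_param D t : Prop := double_param D t /\ pass D t <> Virt.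

(* A classical crossing is the pair (over parameter, under parameter). *)
Definition crossings D : set (R * R) := [set c |
  [/\ 0 <= c.1 < 1, 0 <= c.2 < 1, meets (curve D) c.1 c.2
    & pass D c.1 = Over]].

(* When both strands point upwards, the first goes from bottom left to top
   right and the second from bottom right to top left. *)
Definition left_right D s t : Prop := 0 < det2 (vel D s) (vel D t).

Definition sgn D c : int := sgz (det2 (vel D c.1) (vel D c.2)).

(* An arc labeling, as a function on the circle.  At a classical crossing
   parameter it takes the value of the arc that ends there, i.e. of the
   incoming arc. *)
Definition is_labeling D (lam : R -> int) : Prop :=
  [/\ forall t, lam (t + 1) = lam t,
      forall s t, s <= t ->
        (forall v, s <= v < t -> ~ classical_param D v) -> lam t = lam s,
      forall s u t, meets (curve D) s u -> pass D s <> Virt ->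
        left_right D s u -> s < t ->
        (forall v, s < v < t -> ~ classical_param D v) -> lam t = lam s - 1
    & forall s u t, meets (curve D) s u -> pass D s <> Virt ->
        left_right D u s -> s < t ->
        (forall v, s < v < t -> ~ classical_param D v) -> lam t = lam s + 1].

(* Some labeling; it always exists, and [Ind] does not depend on the choice. *)
Definition label D : R -> int := xget (fun=> 0) [set lam | is_labeling D lam].

(* The left strand is the over-strand iff the sign is 1. *)
Definition Ind D c : int :=
  let lr := if sgn D c == 1 then (c.1, c.2) else (c.2, c.1) in
  sgn D c * (label D lr.1 - label D lr.2 - 1).

Definition writhe D (n : int) : int :=
  \sum_(c \in [set c | crossings D c /\ Ind D c = n]) sgn D c.

Definition dwrithe (n : nat) D : int := writhe D n%:Z - writhe D (- n%:Z).

Definition crossing_change D E : Prop := exists2 c, crossings D c &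
  curve E = curve D /\
  forall t, 0 <= t < 1 -> double_param D t ->
    pass E t = if (t == c.1) || (t == c.2) then opp_passage (pass D t)
               else pass D t.

(** Planar isotopy *)

Definition dx (F : R * R -> R * R) (p : R * R) : R * R := 'D_(1, 0) F p.
Definition dy (F : R * R -> R * R) (p : R * R) : R * R := 'D_(0, 1) F p.

(* A continuous family of C^1 diffeomorphisms of the plane starting at id. *)
Definition ambient_isotopy (Phi : R -> R * R -> R * R) : Prop :=
  let dom : set (R * (R * R)) := `[0, 1]%classic `*` setT in
  [/\ forall p, Phi 0 p = p,
      {within dom, continuous (fun q => Phi q.1 q.2)},
      {within dom, continuous (fun q => dx (Phi q.1) q.2)},
      {within dom, continuous (fun q => dy (Phi q.1) q.2)}
    & forall t, 0 <= t <= 1 -> bijective (Phi t) /\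
        forall p, differentiable (Phi t) p /\
                  det2 (dx (Phi t) p) (dy (Phi t) p) != 0].

(* Lift to R of an orientation-preserving C^1 diffeomorphism of R / Z. *)
Definition circle_diffeo (rho : R -> R) : Prop :=
  [/\ forall t, rho (t + 1) = rho t + 1,
      forall t, derivable rho t 1,
      continuous (rho^`()%classic : R -> R)
    & forall t, 0 < rho^`()%classic t].

Definition planar_isotopic D E : Prop := exists Phi rho,
  [/\ ambient_isotopy Phi, circle_diffeo rho,
      forall t, curve E (rho t) = Phi 1 (curve D t)
    & forall t, double_param D t -> pass E (rho t) = pass D t].

(** Local moves *)

(* The affine map from [-2, 2] onto the segment from a to b; a strand with
   b < a is run through backwards. *)
Definition strand (a b u : R) : R := ((2 - u) * a + (2 + u) * b) / 4.

(* D and E agree outside the box B, which they meet in k strands, equal to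
   sigma_i for D and tau_i for E.  Using a fixed box loses no generality: a
   planar isotopy brings any disc where a move takes place to this position,
   and the base point of the circle out of the disc. *)
Definition local_change (k : nat) (B : set (R * R))
    (sigma tau : 'I_k -> R -> R * R) (a b : 'I_k -> R) D E : Prop :=
  [/\ forall i, [/\ 0 < a i < 1, 0 < b i < 1 & a i != b i],
      forall i j u v, -2 <= u <= 2 -> -2 <= v <= 2 ->
        strand (a i) (b i) u = strand (a j) (b j) v -> i = j,
      forall i u, -2 <= u <= 2 ->
        curve D (strand (a i) (b i) u) = sigma i u /\
        curve E (strand (a i) (b i) u) = tau i u
    & forall t, 0 <= t < 1 ->
        (forall i u, -2 <= u <= 2 -> t <> strand (a i) (b i) u) ->
        [/\ ~ B (curve D t), curve E t = curve D t
          & double_param D t -> pass E t = pass D t]].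

(* [w i j p] : strand i may pass through its crossings with strand j as p. *)
Definition inner_passages (k : nat) (a b : 'I_k -> R)
    (w : 'I_k -> 'I_k -> passage -> Prop) D : Prop :=
  forall i j u v, -2 <= u <= 2 -> -2 <= v <= 2 ->
    meets (curve D) (strand (a i) (b i) u) (strand (a j) (b j) v) ->
    w i j (pass D (strand (a i) (b i) u)).

Definition tangle_move (k : nat) (B : set (R * R))
    (sigma tau : 'I_k -> R -> R * R) (w : 'I_k -> 'I_k -> passage -> Prop)
    D E : Prop := exists a b,
  [/\ local_change B sigma tau a b D E,
      inner_passages a b w D & inner_passages a b w E].

Definition box (x0 x1 y0 y1 : R) : set (R * R) :=
  [set p | (x0 <= p.1 <= x1) && (y0 <= p.2 <= y1)].

(* A hill function, equal to 1 at 1 and -1, with a double zero at 2 and -2: the two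
   sides of each move have the same endpoints and the same end velocities. *)
Definition hill (u : R) : R := (4 - u ^+ 2) ^+ 2 / 9.

(* Type I: a kink with its only double point (0, 1) at u = 1 and u = -1. *)
Definition box1 : set (R * R) := box (-6) 6 (-1) 4.
Definition kink (i : 'I_1) (u : R) : R * R := (u ^+ 3 - u, u ^+ 2).
Definition unkink (i : 'I_1) (u : R) : R * R :=
  (u ^+ 3 - u + u * hill u, u ^+ 2).

(* Type II: a bigon with corners (-1, 0) and (1, 0). *)
Definition box2 : set (R * R) := box (-2) 2 (-2) 2.
Definition bigon (i : 'I_2) (u : R) : R * R :=
  if i == ord0 then (u, 0) else (u, 1 - hill u).
Definition unbigon (i : 'I_2) (u : R) : R * R :=
  if i == ord0 then (u, 0) else (u, 1).

(* Type III: strands 0 and 1 are two diagonals, and strand 2 moves from above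
   their common point to below it. *)
Definition upper_triangle (i : 'I_3) (u : R) : R * R :=
  match val i with 0%N => (u, u) | 1%N => (u, - u) | _ => (u, hill u) end.
Definition lower_triangle (i : 'I_3) (u : R) : R * R :=
  match val i with 0%N => (u, u) | 1%N => (u, - u) | _ => (u, - hill u) end.

Definition all_virtual (k : nat) (i j : 'I_k) (p : passage) : Prop := p = Virt.

Definition by_height (k : nat) (ht : 'I_k -> nat) (i j : 'I_k) (p : passage) :
  Prop := p = if (ht j < ht i)%N then Over else Under.

Inductive vmove D E : Prop :=
| Isotopy of planar_isotopic D E
| RI of tangle_move box1 kink unkink (fun _ _ p => p <> Virt) D E
| RII ht of injective ht &
    tangle_move box2 bigon unbigon (by_height ht) D E
| RIII ht of injective ht &
    tangle_move box2 upper_triangle lower_triangle (by_height ht) D E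
| VRI of tangle_move box1 kink unkink (@all_virtual 1) D E
| VRII of tangle_move box2 bigon unbigon (@all_virtual 2) D E
| VRIII of
    tangle_move box2 upper_triangle lower_triangle (@all_virtual 3) D E
| SV ht of injective ht &
    tangle_move box2 upper_triangle lower_triangle
      (fun i j p => if (i == ord_max) || (j == ord_max) then p = Virt
                    else by_height ht i j p) D E.

(* An oriented virtual knot is a class of this equivalence relation. *)
Definition vequiv : vdiagram R -> vdiagram R -> Prop :=
  @clos_refl_sym_trans (vdiagram R) vmove.

Definition virtual_knot_invariant (T : Type) (f : vdiagram R -> T) : Prop :=
  forall D E, vequiv D E -> f D = f E.

Definition flat_virtual_knot_invariant (T : Type) (f : vdiagram R -> T) :
  Prop := virtual_knot_invariant f /\
  forall D E, crossing_change D E -> f E = f D.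

End Diagrams.

(* Main.v *)
Require Import Defs.
From mathcomp Require Import all_boot all_order all_algebra.
From mathcomp Require Import all_classical all_reals all_analysis.
From mathcomp Require Import zify ring lra.
(* [meets] is to denote double points of curves, not filters that meet. *)
Import Defs.

(** Forget which strand of each classical crossing is the upper one, and keep
    its left and its right strand: the diagram becomes a finite set of arrows on
    the circle R / Z, from the left parameter to the right one.  A labeling of
    the arcs increases by 1 at each head of an arrow and decreases by 1 at each
    tail ([arrow_label_labeling]), and this determines it up to a constant
    ([labeling_unique]).  So [Ind c = sgn c * w], where [w] is the sum of the
    linkings of the arrow of [c] with the other arrows ([Ind_arrow]).  Write
    e(k) for the number 1 if [k = n], -1 if [k = - n], and 0 otherwise.  A
    crossing of sign [s] contributes [s * e(s * w)] to the dwrithe; as e is odd,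
    this is [e(w)] for both signs.  The dwrithe is therefore a function of the
    arrows alone ([dwrithe_flat]), and crossing changes do not affect it.

    A planar isotopy preserves the orientation of the plane and that of the
    circle, hence the arrows and their linkings ([isotopy_dwrithe]).  A local
    move changes the arrows inside the moving strands only
    ([tangle_move_dwrithe]).  The first move adds an arrow of index 0, isolated
    from the others ([flatwrithe_isolated]).  The second adds two parallel
    arrows of opposite directions: their indices are opposite, their contributions
    cancel, and so do their effects on the other indices
    ([flatwrithe_opposite]).  In the third, the ends of the three arrows are
    exchanged in pairs on each strand, and the changes of the linkings cancel in
    the index of each arrow ([triangle_links]); this is a finite computation,
    over the directions of the three strands.  The moves with virtual crossings
    preserve the arrows. *)

Set Implicit Arguments.
Unset Strict Implicit.
Unset Printing Implicit Defensive.

Import Order.TTheory GRing.Theory Num.Theory.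
Import numFieldNormedType.Exports.

Local Open Scope classical_set_scope.
Local Open Scope ring_scope.

(** * Arrow diagrams on the circle *)

Section ArrowDiagrams.
Variable R : realType.
Implicit Types (x y t : R) (c : R * R) (s : seq (R * R)) (n w : int).

(** The circle is R / Z.  [gap x y] is the number of integers [k >= 0] with
    [x + k < y], or minus the number of [k < 0] with [y <= x + k]: as a function
    of [y], it jumps by 1 just after each lift of [x].  For [x] and [y] in
    [0, 1) it is 1 or 0, as [x < y] or not. *)
Definition gap x y : int := Num.ceil (y - x).

Lemma gapP x y (k : int) : (gap x y == k) = (x + (k - 1)%:~R < y <= x + k%:~R).
Proof. by rewrite /gap ceil_eq ltrBrDl lerBlDl. Qed.

Lemma gap_eq x y x' y' :
  (forall k : int, (y <= x + k%:~R) = (y' <= x' + k%:~R)) ->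
  gap x y = gap x' y'.
Proof.
by move=> le_xy; apply/eqP; rewrite gapP ltNge !le_xy -ltNge -gapP.
Qed.

Lemma gapDr x y (m : int) : gap x (y + m%:~R) = gap x y + m.
Proof.
by rewrite /gap addrAC ceilDrz ?rpred_int //; congr (_ + _); exact: intrKceil.
Qed.

Lemma gapDl x y (m : int) : gap (x + m%:~R) y = gap x y - m.
Proof. by rewrite -gapDr /gap rmorphN opprD addrA addrAC. Qed.

Lemma gap_unit x y : 0 <= x < 1 -> 0 <= y < 1 -> gap x y = (x < y)%R%:Z.
Proof.
move=> x01 y01; apply/eqP; rewrite gapP.
case: (ltP x y) => xy.
  have -> : (1%:Z - 1)%:~R = 0 :> R by [].
  by have -> : 1%:Z%:~R = 1 :> R by []; lra.
have -> : (0%:Z - 1)%:~R = -1 :> R by [].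
by have -> : 0%:Z%:~R = 0 :> R by []; lra.
Qed.

(** An arrow [c] runs from its tail [c.1] to its head [c.2].  [link c c'] counts
    the ends of [c'] met when travelling from the head of [c], included, to its
    tail, excluded: 1 for the head of [c'] and -1 for its tail.  Integer
    translations of the four ends do not change it, so that it makes sense on
    the circle. *)
Definition link c c' : int :=
  gap c'.2 c.1 - gap c'.1 c.1 - gap c'.2 c.2 + gap c'.1 c.2.

Lemma link_flipl c c' : link (c.2, c.1) c' = - link c c'.
Proof. by rewrite /link; ring. Qed.

Lemma link_flipr c c' : link c (c'.2, c'.1) = - link c c'.
Proof. by rewrite /link; ring. Qed.

Lemma gap_swap x y : 0 <= x < 1 -> 0 <= y < 1 -> x != y ->
  gap x y + gap y x = 1.
Proof. by move=> x01 y01; rewrite !gap_unit //; case: ltgtP. Qed.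

Lemma link_self c : 0 <= c.1 < 1 -> 0 <= c.2 < 1 -> c.1 != c.2 -> link c c = 1.
Proof.
move=> c1 c2 ne; rewrite /link /gap !subrr ceil0 -!/(gap _ _).
by rewrite !subr0 addrC gap_swap.
Qed.

(** The linking of two arrows with four different ends is antisymmetric. *)
Lemma link_antisym c d : 0 <= c.1 < 1 -> 0 <= c.2 < 1 ->
  0 <= d.1 < 1 -> 0 <= d.2 < 1 ->
  c.1 != d.1 -> c.1 != d.2 -> c.2 != d.1 -> c.2 != d.2 ->
  link c d + link d c = 0.
Proof.
move=> c1 c2 d1 d2 n11 n12 n21 n22; rewrite /link.
have e11 := gap_swap c1 d1 n11; have e12 := gap_swap c1 d2 n12.
have e21 := gap_swap c2 d1 n21; have e22 := gap_swap c2 d2 n22.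
by lra.
Qed.

(** The arrow diagram is the list of its arrows.  The index of an arrow is its
    linking with all the others: subtracting 1 removes that with itself. *)
Definition windex s c : int := \sum_(c' <- s) link c c' - 1.

(** The contribution to the [n]-th dwrithe of a crossing whose index is [w] up
    to sign. *)
Definition jump n w : int := (w == n)%:Z - (w == - n)%:Z.

(** The [n]-th dwrithe, as a function of the arrow diagram. *)
Definition flatwrithe n s : int := \sum_(c <- s) jump n (windex s c).

Lemma jumpN n w : jump n (- w) = - jump n w.
Proof. by rewrite /jump eqr_opp eqr_oppLR opprB. Qed.

Lemma jump0 n : jump n 0 = 0.
Proof. by rewrite /jump [0 == - n]eq_sym oppr_eq0 eq_sym subrr. Qed.

Lemma flatwrithe_map n s (f : R * R -> R * R) :
  {in s &, forall c c', link (f c) (f c') = link c c'} ->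
  flatwrithe n (map f s) = flatwrithe n s.
Proof.
move=> fl; rewrite /flatwrithe big_map; apply: eq_big_seq => c cs.
rewrite /windex big_map; congr (jump n (_ - 1)); apply: eq_big_seq => c' c's.
exact: fl.
Qed.

(** Isolated arrows have index 0 and do not affect other indices. *)
Lemma flatwrithe_isolated n s c : link c c = 1 ->
  {in s, forall c', link c c' = 0 /\ link c' c = 0} ->
  flatwrithe n (c :: s) = flatwrithe n s.
Proof.
move=> lcc cs; rewrite /flatwrithe big_cons.
have -> : windex (c :: s) c = 0.
  rewrite /windex big_cons lcc big1_seq ?addr0 ?subrr // => c' /andP[_ c's].
  by have [] := cs _ c's.
rewrite jump0 add0r; apply: eq_big_seq => c' c's.
by rewrite /windex big_cons (cs _ c's).2 add0r.
Qed.

(** Two parallel arrows of opposite directions have opposite indices, and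
    their effects on every other index cancel. *)
Lemma flatwrithe_opposite n s c d : link c c = 1 -> link d d = 1 ->
  link c d + link d c = 0 ->
  {in s, forall e, link c e + link d e = 0 /\ link e c + link e d = 0} ->
  flatwrithe n [:: c, d & s] = flatwrithe n s.
Proof.
move=> lcc ldd lcd cds; rewrite /flatwrithe !big_cons.
have -> : windex [:: c, d & s] d = - windex [:: c, d & s] c.
  rewrite /windex !big_cons lcc ldd.
  have : \sum_(e <- s) link c e + \sum_(e <- s) link d e = 0.
    by rewrite -big_split big1_seq // => e /cds[].
  by move: (\sum_(e <- s) link c e) (\sum_(e <- s) link d e) => x y; lia.
rewrite jumpN addrA subrr add0r; apply: eq_big_seq => e es.
by rewrite /windex !big_cons addrA (cds _ es).2 add0r.
Qed.

(** Replacement of some arrows, indices being preserved. *)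
Lemma flatwrithe_replace n (I : eqType) (r : seq I) (f g : I -> R * R) s :
  {in r & s, forall i c,
     link (f i) c = link (g i) c /\ link c (f i) = link c (g i)} ->
  {in r, forall i,
     \sum_(j <- r) link (f i) (f j) = \sum_(j <- r) link (g i) (g j)} ->
  flatwrithe n (map f r ++ s) = flatwrithe n (map g r ++ s).
Proof.
move=> fgs fg; rewrite /flatwrithe !big_cat !big_map /=; congr (_ + _).
  apply: eq_big_seq => i ir; rewrite /windex !big_cat !big_map /= fg //.
  by congr (jump n (_ + _ - 1)); apply: eq_big_seq => c /(fgs _ _ ir)[].
apply: eq_big_seq => c cs; rewrite /windex !big_cat !big_map /=.
congr (jump n (_ + _ - 1)); apply: eq_big_seq => i ir.
by have [] := fgs i c ir cs.
Qed.

End ArrowDiagrams.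

(** * The dwrithe as a count of flat crossings *)

Section FlatCrossings.
Variable R : realType.
Implicit Types (D E : vdiagram R) (c : R * R) (s t u v : R).

Lemma meets_sym (g : R -> R * R) s t : meets g s t -> meets g t s.
Proof. by case=> gst st; split; rewrite // -opprB rpredN. Qed.

Lemma periodic_int (T : Type) (f : R -> T) (k : int) t :
  (forall v, f (v + 1) = f v) -> f (t + k%:~R) = f t.
Proof.
move=> f1; have fn (m : nat) v : f (v + m%:R) = f v.
  by elim: m => [|m IH]; rewrite ?addr0 // -natr1 addrA f1.
by case: (intP k) => [|m|m]; rewrite ?addr0 ?fn // -[LHS](fn m.+1) mulrNz subrK.
Qed.

Lemma curveDz D t (k : int) : curve D (t + k%:~R) = curve D t.
Proof. exact/periodic_int/curve_periodic. Qed.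

Lemma passDz D t (k : int) : pass D (t + k%:~R) = pass D t.
Proof. exact/periodic_int/pass_periodic. Qed.

Lemma velDz D t (k : int) : vel D (t + k%:~R) = vel D t.
Proof.
apply: periodic_int => v; rewrite /vel /derive1.
suff -> : (fun h : R => h^-1 *: (curve D (h + (v + 1)) - curve D (v + 1))) =
  (fun h => h^-1 *: (curve D (h + v) - curve D v)) by [].
by apply/funext => h; rewrite addrA !curve_periodic.
Qed.

Lemma meetsDz D s t (k m : int) :
  meets (curve D) (s + k%:~R) (t + m%:~R) <-> meets (curve D) s t.
Proof.
rewrite /meets !curveDz; suff -> : (s + k%:~R - (t + m%:~R) \is a Num.int) =
  (s - t \is a Num.int) by [].
have -> : s + k%:~R - (t + m%:~R) = s - t + (k - m)%:~R.
  by rewrite rmorphB /=; ring.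
by rewrite rpredDr ?rpred_int.
Qed.

Lemma left_rightDz D s t (k m : int) :
  left_right D (s + k%:~R) (t + m%:~R) = left_right D s t.
Proof. by rewrite /left_right !velDz. Qed.

Lemma int_unit_eq s t : 0 <= s < 1 -> 0 <= t < 1 ->
  s - t \is a Num.int -> s = t.
Proof.
move=> s01 t01 /intrP[k stk]; apply/eqP; rewrite -subr_eq0 stk intr_eq0.
have : -1 < k%:~R :> R by rewrite -stk; lra.
have : k%:~R < 1 :> R by rewrite -stk; lra.
by rewrite -[-1]/((-1)%:~R) -[X in _ < X]/(1%:~R) !ltr_int; lia.
Qed.

Lemma unit_floor t : 0 <= t - (Num.floor t)%:~R < 1.
Proof. by have := floor_itv t; rewrite rmorphD /=; lra. Qed.

Lemma det2C (p q : R * R) : det2 q p = - det2 p q.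
Proof. by rewrite /det2; ring. Qed.

(** Transversality makes exactly one of the two strands the left one. *)
Lemma left_right_asym D s t : left_right D s t -> ~ left_right D t s.
Proof.
rewrite /left_right; move: (vel D s) (vel D t) => p q pq.
by rewrite det2C oppr_gt0 => /(lt_trans pq); rewrite ltxx.
Qed.

Lemma left_right_total D s t : meets (curve D) s t ->
  left_right D s t \/ left_right D t s.
Proof.
move/curve_transversal; rewrite /left_right -!/(vel D _).
move: (vel D s) (vel D t) => p q; rewrite (det2C p q) oppr_gt0.
by case: (ltgtP 0 (det2 p q)); auto.
Qed.

Lemma pass_meets D s t : meets (curve D) s t ->
  pass D s <> Virt -> pass D t <> Virt.
Proof. by move=> /pass_opp ->; case: (pass D s). Qed.

(** The classical crossings, with the over/under information forgotten, each
    given by its left and its right strand. *)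
Definition arrows D : set (R * R) := [set c |
  [/\ 0 <= c.1 < 1, 0 <= c.2 < 1, meets (curve D) c.1 c.2, pass D c.1 <> Virt
    & left_right D c.1 c.2]].

(** A list of the elements of a set, without repetition. *)
Definition enumerates (r : seq (R * R)) (A : set (R * R)) : Prop :=
  uniq r /\ forall c, c \in r <-> A c.

Lemma enumerates_perm r r' A : enumerates r A -> enumerates r' A ->
  perm_eq r r'.
Proof.
move=> [ur rA] [ur' r'A]; apply: uniq_perm => // c.
by apply/idP/idP => [/rA/r'A|/r'A/rA].
Qed.

Lemma finite_enumerates A : finite_set A -> exists r, enumerates r A.
Proof.
move=> fA; exists (finmap.enum_fset (fset_set A)); split.
  exact: finmap.fset_uniq.
by move=> c; have := in_fset_set fA c; rewrite /= => ->; rewrite in_setE.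
Qed.

Lemma crossings_enum D : exists r, enumerates r (crossings D).
Proof.
apply: finite_enumerates; apply: sub_finite_set (curve_finite D) => c.
by case=> ? ? ? _; split.
Qed.

Lemma arrows_enum D : exists r, enumerates r (arrows D).
Proof.
apply: finite_enumerates; apply: sub_finite_set (curve_finite D) => c.
by case=> ? ? ? _; split.
Qed.

(** Any two parameters of a classical crossing give an arrow, once they are
    brought back to [0, 1). *)
Lemma arrow_unit D s t : meets (curve D) s t -> pass D s <> Virt ->
  left_right D s t ->
  arrows D (s - (Num.floor s)%:~R, t - (Num.floor t)%:~R).
Proof.
move=> st ps lr.
have eN (v : R) : v - (Num.floor v)%:~R = v + (- Num.floor v)%:~R.
  by rewrite mulrNz.
split.
- exact: unit_floor.
- exact: unit_floor.
- by rewrite /= !eN; apply/meetsDz.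
- by rewrite [X in pass D X]eN passDz.
- by rewrite /= !eN left_rightDz.
Qed.

(** Each end of an arrow determines the arrow. *)
Lemma arrow_functional D c d : arrows D c -> arrows D d ->
  c.1 = d.1 \/ c.2 = d.2 -> c = d.
Proof.
case: c d => [c1 c2] [d1 d2] [/= c101 c201 mc _ _] [/= d101 d201 md _ _].
case=> e; rewrite -?e in md *.
  by rewrite (int_unit_eq c201 d201) //; apply: curve_no_triple mc md.
rewrite (int_unit_eq c101 d101) //.
by apply: curve_no_triple (meets_sym mc) (meets_sym md).
Qed.

Lemma arrow_source_target D c d : arrows D c -> arrows D d -> c.1 <> d.2.
Proof.
case: c d => [c1 c2] [d1 d2] [/= c101 c201 mc _ lc] [/= d101 d201 md _ ld] e.
rewrite -e in md ld; apply: (left_right_asym lc).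
rewrite (int_unit_eq c201 d101) //.
by apply: curve_no_triple mc (meets_sym md).
Qed.

Lemma arrow_classical D c (k : int) : arrows D c ->
  classical_param D (c.1 + k%:~R) /\ classical_param D (c.2 + k%:~R).
Proof.
case=> _ _ mc pc _; rewrite /classical_param !passDz; do !split => //.
- by exists c.2; rewrite -[c.2]addr0 -(mulr0z 1); apply/meetsDz.
- by exists c.1; rewrite -[c.1]addr0 -(mulr0z 1); apply/meetsDz/meets_sym.
- exact: pass_meets pc.
Qed.

(** * Labels *)

(** Travelling along the knot, the label increases by 1 at each head of an
    arrow and decreases by 1 at each tail.  Each arrow contributes a periodic
    function, so the sum is a function on the circle. *)
Definition arrow_label (r : seq (R * R)) t : int :=
  \sum_(c <- r) (gap c.2 t - gap c.1 t).

Lemma gap_const v x y : x <= y -> (forall k : int, ~ (x <= v + k%:~R < y)) ->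
  gap v y = gap v x.
Proof.
move=> xy nv; apply: gap_eq => k; apply/idP/idP => [|xk]; first exact: le_trans.
by rewrite leNgt; apply/negP => yk; apply: (nv k); rewrite xk.
Qed.

(** [gap v] jumps by 1 at [x] if [x] is a lift of [v], and is otherwise constant
    up to the next lift of [v]. *)
Lemma gap_step v x y : x < y -> (forall k : int, ~ (x < v + k%:~R < y)) ->
  0 <= v < 1 -> gap v y = gap v x + (v == x - (Num.floor x)%:~R)%:Z.
Proof.
move=> xy nv v01; have [ev|/eqP vx] := eqVneq v (x - (Num.floor x)%:~R).
  set f := Num.floor x in ev; have -> : gap v x = f.
    by rewrite -[x](subrK f%:~R) -ev gapDr /gap subrr ceil0 add0r.
  apply/eqP; rewrite gapP [f + _ - _]addrK ev subrK xy leNgt.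
  apply/negP => lt_y; apply: (nv (f + 1)).
  by apply/andP; split; [rewrite ev intrD; lra | rewrite ev; exact: lt_y].
rewrite addr0; apply: gap_const (ltW xy) _ => k; rewrite le_eqVlt.
case/andP=> /orP[/eqP xk|xk] ky; last by apply: (nv k); rewrite xk.
apply: vx; apply: int_unit_eq => //; first exact: unit_floor.
have -> : v - (x - (Num.floor x)%:~R) = (Num.floor x - k)%:~R.
  by rewrite xk rmorphB /=; ring.
exact: rpred_int.
Qed.

Lemma arrow_label_step D r x y : enumerates r (arrows D) -> x < y ->
  (forall v, x < v < y -> ~ classical_param D v) ->
  arrow_label r y = arrow_label r x +
    \sum_(c <- r) ((c.2 == x - (Num.floor x)%:~R)%:Z
                   - (c.1 == x - (Num.floor x)%:~R)%:Z).
Proof.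
move=> [_ rD] xy nc; rewrite /arrow_label -big_split /=.
apply: eq_big_seq => c /rD cD; have [c1 c2 _ _ _] := cD.
rewrite !(@gap_step _ x y) //; first by ring.
  by move=> k /nc; case; have [] := arrow_classical k cD.
by move=> k /nc; case; have [] := arrow_classical k cD.
Qed.

Lemma sum_pred1 (T : eqType) (r : seq T) (x : T) : uniq r -> x \in r ->
  \sum_(y <- r) (y == x)%:Z = 1.
Proof.
move=> ur xr; rewrite (bigD1_seq x) //= eqxx big1 ?addr0 // => y.
by move=> /negPf ->.
Qed.

Lemma arrow_label_labeling D r : enumerates r (arrows D) ->
  is_labeling D (arrow_label r).
Proof.
move=> rD; have [ur r_arrow] := rD; split=> [t|s t st nc|s u t m p lr st nc|].
- apply: eq_bigr => c _.
  by rewrite -[1]/(1%:~R) !gapDr opprD addrACA subrr addr0.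
- apply: eq_big_seq => c /r_arrow cD.
  by rewrite !(@gap_const _ s t) // => k /nc; case;
    have [] := arrow_classical k cD.
- rewrite (arrow_label_step rD st nc); congr (_ + _).
  have aD := arrow_unit m p lr; set c0 := (_, _) in aD.
  rewrite -[RHS]/(- (1 : int)) -(sum_pred1 ur (proj2 (r_arrow c0) aD)) -sumrN.
  apply: eq_big_seq => c /r_arrow cD.
  rewrite -[s - _]/(c0.1); have -> : (c.2 == c0.1) = false.
    by apply/eqP => e; apply: (arrow_source_target aD cD).
  rewrite sub0r; congr (- (nat_of_bool _)%:Z); apply/eqP/eqP => [e|-> //].
  by apply: (arrow_functional cD aD); left.
move=> s u t m p lr st nc.
rewrite (arrow_label_step rD st nc); congr (_ + _).
have aD := arrow_unit (meets_sym m) (pass_meets m p) lr.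
set c0 := (_, _) in aD.
rewrite -(sum_pred1 ur (proj2 (r_arrow c0) aD)).
apply: eq_big_seq => c /r_arrow cD.
rewrite -[s - _]/(c0.2); have -> : (c.1 == c0.2) = false.
  by apply/eqP; apply: (arrow_source_target cD aD).
rewrite subr0; congr (nat_of_bool _)%:Z; apply/eqP/eqP => [e|-> //].
by apply: (arrow_functional cD aD); right.
Qed.

Lemma labeling_step D lam mu x y : is_labeling D lam -> is_labeling D mu ->
  x < y -> (forall v, x < v < y -> ~ classical_param D v) ->
  lam y - lam x = mu y - mu x.
Proof.
move=> [_ l0 lL lR] [_ m0 mL mR] xy nc.
have [[[u m] p]|ncx] := pselect (classical_param D x).
  have [lr|lr] := left_right_total m.
    by rewrite (lL _ _ _ m p lr xy nc) (mL _ _ _ m p lr xy nc); ring.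
  by rewrite (lR _ _ _ m p lr xy nc) (mR _ _ _ m p lr xy nc); ring.
have nc' v : x <= v < y -> ~ classical_param D v.
  by rewrite le_eqVlt => /andP[/orP[/eqP <- //|xv vy]]; apply: nc; rewrite xv.
by rewrite (l0 _ _ (ltW xy) nc') (m0 _ _ (ltW xy) nc') !subrr.
Qed.

(** Two labelings differ by a constant.  The induction is on a list containing
    the crossing parameters between [x] and [y], at one of which the interval is
    cut. *)
Lemma labeling_unique D lam mu (r : seq R) x y :
  is_labeling D lam -> is_labeling D mu -> x <= y ->
  (forall v, x < v < y -> classical_param D v -> v \in r) ->
  lam y - lam x = mu y - mu x.
Proof.
move=> lamD muD; elim: r x y => [|w r IH] x y.
  rewrite le_eqVlt => /orP[/eqP -> _|xy nc]; first by rewrite !subrr.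
  by apply: labeling_step lamD muD xy _ => v /nc vr /vr.
move=> xy nc; have [/andP[xw wy]|xwy] := boolP (x < w < y).
  have -> : lam y - lam x = (lam y - lam w) + (lam w - lam x) by ring.
  have -> : mu y - mu x = (mu y - mu w) + (mu w - mu x) by ring.
  congr (_ + _); apply: IH (ltW _) _ => // v /andP[v1 v2] cv.
    have /nc : x < v < y by rewrite v2 (lt_trans xw).
    by move=> /(_ cv); rewrite inE => /orP[/eqP vw|//]; rewrite vw ltxx in v1.
  have /nc : x < v < y by rewrite v1 (lt_trans v2).
  by move=> /(_ cv); rewrite inE => /orP[/eqP vw|//]; rewrite vw ltxx in v2.
apply: IH xy _ => v vxy /(nc _ vxy); rewrite inE => /orP[/eqP vw|//].
by rewrite -vw vxy in xwy.
Qed.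

Lemma labelB D r x y : enumerates r (arrows D) ->
  0 <= x < 1 -> 0 <= y < 1 ->
  label D x - label D y = arrow_label r x - arrow_label r y.
Proof.
move=> rD; have labD : is_labeling D (label D).
  by apply: xgetPex; exists (arrow_label r); exact: arrow_label_labeling.
wlog yx : x y / y <= x.
  move=> wl x01 y01; have [/wl->//|/ltW/wl e] := leP y x.
  by rewrite -opprB e // opprB.
move=> x01 y01.
apply: (labeling_unique (r := map fst r ++ map snd r)) labD _ yx _.
  exact: arrow_label_labeling.
move=> v vxy [[u m] p]; rewrite mem_cat.
have v01 : 0 <= v < 1 by lra.
have v0 : v - (Num.floor v)%:~R = v.
  apply: int_unit_eq => //; first exact: unit_floor.
  by rewrite addrAC subrr add0r rpredN rpred_int.
have [lr|lr] := left_right_total m; apply/orP; [left|right].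
  have /rD.2 := arrow_unit m p lr; rewrite v0; exact: (map_f fst).
have /rD.2 := arrow_unit (meets_sym m) (pass_meets m p) lr; rewrite v0.
exact: (map_f snd).
Qed.

(** * The flat formula *)

(** The arrow of a classical crossing given by its over and under parameters. *)
Definition left_right_pair D c : R * R :=
  if sgn D c == 1 then (c.1, c.2) else (c.2, c.1).

Lemma sgnP D c : crossings D c ->
  (sgn D c = 1 /\ left_right D c.1 c.2) \/
  (sgn D c = -1 /\ left_right D c.2 c.1).
Proof.
case=> _ _ m _; have [lr|lr] := left_right_total m; [left|right]; split=> //.
  by apply/eqP; rewrite /sgn sgz_cp0.
by apply/eqP; rewrite /sgn sgz_cp0 det2C oppr_lt0.
Qed.

Lemma left_right_pair_arrow D c : crossings D c ->
  arrows D (left_right_pair D c).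
Proof.
move=> cD; have [c1 c2 m p] := cD; rewrite /left_right_pair.
have p' : pass D c.1 <> Virt by rewrite p.
have [[-> lr]|[-> lr]] := sgnP cD; rewrite ?eqxx /=; split=> //=.
  exact: meets_sym.
exact: pass_meets p'.
Qed.

(** Each arrow comes from exactly one crossing. *)
Lemma left_right_pair_enum D X : enumerates X (crossings D) ->
  enumerates (map (left_right_pair D) X) (arrows D).
Proof.
move=> [uX XD]; split; last first.
  move=> c; split=> [/mapP[d /XD dD ->]|[c1 c2 m p lr]].
    exact: left_right_pair_arrow.
  have sc : sgn D c = 1 by apply/eqP; rewrite /sgn sgz_cp0.
  case pc : (pass D c.1) p => // _.
    have cX : c \in X by apply/XD; split.
    apply/mapP; exists c => //.
    by rewrite /left_right_pair sc eqxx -surjective_pairing.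
  have cX : (c.2, c.1) \in X.
    by apply/XD; split=> //=; [exact: meets_sym | rewrite (pass_opp m) pc].
  apply/mapP; exists (c.2, c.1) => //; rewrite /left_right_pair.
  have -> : sgn D (c.2, c.1) = -1.
    by apply/eqP; rewrite /sgn /= sgz_cp0 det2C oppr_lt0.
  by rewrite /= -surjective_pairing.
rewrite map_inj_in_uniq // => -[c1 c2] [d1 d2] /XD[_ _ mc pc] /XD[_ _ md pd].
rewrite /= in mc pc md pd.
have opp : pass D c2 = Over -> False by rewrite (pass_opp mc) pc.
have lrE c : left_right_pair D c = c \/ left_right_pair D c = (c.2, c.1).
  by rewrite /left_right_pair; case: ifP; case: c; auto.
have [->|->] := lrE (c1, c2); have [->|->] := lrE (d1, d2); case=> e1 e2.
- by rewrite e1 e2.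
- by case: opp; rewrite e2.
- by case: opp; rewrite e1.
- by rewrite e1 e2.
Qed.

(** The sign enters the index only as a factor. *)
Lemma Ind_arrow D r c : enumerates r (arrows D) -> crossings D c ->
  Ind D c = sgn D c * windex r (left_right_pair D c).
Proof.
move=> rD cD; have [c1 c2 _ _ _] := left_right_pair_arrow cD.
rewrite /Ind -/(left_right_pair D c) (labelB rD) // /windex /arrow_label.
rewrite -sumrB; congr (_ * (_ - 1)); apply: eq_bigr => d _.
by rewrite /link; ring.
Qed.

Lemma writhe_enum D X (n : int) : enumerates X (crossings D) ->
  writhe D n = \sum_(c <- X | Ind D c == n) sgn D c.
Proof.
move=> [uX XD]; rewrite -big_filter fsbig_seq ?filter_uniq //; apply: eq_fsbigl.
apply/seteqP; split=> c /=; rewrite mem_filter.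
  by move=> [/XD -> ->]; rewrite eqxx.
by case/andP=> /eqP -> /XD.
Qed.

(** Signs cancel because [jump n] is odd. *)
Lemma dwrithe_flat D r (n : nat) : enumerates r (arrows D) ->
  dwrithe n D = flatwrithe n%:Z r.
Proof.
move=> rD; have [X XD] := crossings_enum D.
have XrD := left_right_pair_enum XD.
rewrite /flatwrithe (perm_big _ (enumerates_perm rD XrD)) big_map /=.
rewrite /dwrithe !(writhe_enum _ XD) !(big_mkcond (fun _ => _ == _)) -sumrB /=.
apply: eq_big_seq => c /XD.2 cD; rewrite (Ind_arrow rD cD) /jump.
have [[-> _]|[-> _]] := sgnP cD; first by rewrite !mul1r; do 2!case: eqP.
rewrite !mulN1r eqr_opp eqr_oppLR.
by do 2!case: eqP.
Qed.

Lemma dwrithe_eq_arrows D E (n : nat) : arrows D = arrows E ->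
  dwrithe n D = dwrithe n E.
Proof.
move=> DE; have [r rD] := arrows_enum D.
by rewrite (dwrithe_flat _ rD); rewrite DE in rD; rewrite (dwrithe_flat _ rD).
Qed.

Lemma dwrithe_crossing_change D E (n : nat) : crossing_change D E ->
  dwrithe n E = dwrithe n D.
Proof.
case=> c cD [cE pE]; apply: dwrithe_eq_arrows.
rewrite /arrows /left_right /vel cE; apply/seteqP.
have virt t u : 0 <= t < 1 -> meets (curve D) t u ->
    (pass E t <> Virt) <-> (pass D t <> Virt).
  move=> t01 m; rewrite (pE _ t01); last by exists u.
  by case: ifP => // _; case: (pass D t).
by split=> d [d1 d2 m p lr]; split=> //; apply/(virt _ _ d1 m).
Qed.

End FlatCrossings.

(** * Planar isotopy *)

Section Isotopy.
Variable R : realType.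
Implicit Types (D E : vdiagram R) (c : R * R) (s t u v : R).

Lemma IVT_sign (f : R -> R) : {within `[0, 1], continuous f} ->
  (forall t, 0 <= t <= 1 -> f t != 0) -> 0 < f 0 -> 0 < f 1.
Proof.
move=> fc f0 f_gt0; rewrite ltNge; apply/negP => f1.
have [|c] := @IVT R f 0 1 0 ler01 fc.
  by rewrite ge_min le_max f1 (ltW f_gt0) orbT.
by rewrite in_itv /= => c01 fc0; have := f0 _ c01; rewrite fc0 eqxx.
Qed.

Lemma continuous_det2 (T : topologicalType) (f g : T -> R * R) :
  continuous f -> continuous g -> continuous (fun x : T => det2 (f x) (g x)).
Proof.
move=> fc gc t; rewrite /det2.
have c1 (h : T -> R * R) : continuous h -> (h x).1 @[x --> t] --> (h t).1.
  by move=> /(_ t) hc; apply: cvg_comp hc _; exact: cvg_fst.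
have c2 (h : T -> R * R) : continuous h -> (h x).2 @[x --> t] --> (h t).2.
  by move=> /(_ t) hc; apply: cvg_comp hc _; exact: cvg_snd.
by apply: cvgB; apply: cvgM; auto.
Qed.

Lemma within_section (T : topologicalType) (F : R * (R * R) -> T) (p : R * R) :
  {within `[0, 1] `*` setT, continuous F} ->
  {within `[0, 1], continuous (fun t => F (t, p))}.
Proof.
move=> /subspace_continuousP Fc; apply/subspace_continuousP => t t01.
apply: cvg_comp (Fc (t, p) _); last by split.
move=> U [[V W] /= [tV pW] VWU]; move: tV; apply: filterS => v Vv v01.
by apply: (VWU (v, p)); split => //=; exact: nbhs_singleton.
Qed.

(** The final diffeomorphism preserves the orientation: its Jacobian determinant
    is never 0 during the isotopy and is 1 at the beginning. *)
Lemma ambient_isotopy_det (Phi : R -> R * R -> R * R) p : ambient_isotopy Phi ->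
  0 < det2 (dx (Phi 1) p) (dy (Phi 1) p).
Proof.
case=> Phi0 _ dxc dyc Phid.
apply: (IVT_sign (f := fun t => det2 (dx (Phi t) p) (dy (Phi t) p))).
- by apply: continuous_det2; [exact: (within_section (p := p) dxc)
    | exact: (within_section (p := p) dyc)].
- by move=> t /Phid[_ /(_ p)[]].
have -> : Phi 0 = id by apply/funext.
by rewrite /dx /dy !derive_id /det2 /= mulr1 mulr0 subr0.
Qed.

Lemma diff_plane (F : R * R -> R * R) p (v : R * R) : differentiable F p ->
  'd F p v = v.1 *: dx F p + v.2 *: dy F p.
Proof.
move=> Fd; rewrite /dx /dy !deriveE // -!linearZ -linearD; congr ('d F p _).
case: v => v1 v2; transitivity (v1 * 1 + v2 * 0, v1 * 0 + v2 * 1) => //.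
by rewrite !mulr1 !mulr0 addr0 add0r.
Qed.

Section CircleDiffeo.
Variables (rho : R -> R).
Hypothesis rhoP : circle_diffeo rho.

Let rho_deriv t : derivable rho t 1. Proof. by case: rhoP. Qed.

Let rho_cont : continuous rho.
Proof. by move=> t; apply/differentiable_continuous/derivable1_diffP. Qed.

Lemma circle_diffeo_mono : {mono rho : s t / s <= t}.
Proof.
apply: le_mono => s t st; have [_ _ _ rho0] := rhoP.
by apply: (@gtr0_derive1_incr _ rho s t) => //; exact: continuous_subspaceT.
Qed.

Lemma circle_diffeoDz t (k : int) : rho (t + k%:~R) = rho t + k%:~R.
Proof.
have [rho1 _ _ _] := rhoP.
have e v : rho (v + 1) - (v + 1) = rho v - v by rewrite rho1; ring.
have := periodic_int k t e => /(congr1 (fun z => z + (t + k%:~R))).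
by rewrite subrK => ->; ring.
Qed.

Lemma circle_diffeo_surj y : exists t, rho t = y.
Proof.
pose k := Num.floor (y - rho 0); have := floor_itv (y - rho 0).
rewrite -/k intrD => yk.
have [|||t _ <-] := @IVT R rho k%:~R (k + 1)%:~R y; last by exists t.
- by rewrite ler_int; lia.
- exact: continuous_subspaceT.
have := circle_diffeoDz 0; rewrite /= => e.
rewrite -[k%:~R]add0r -[(k + 1)%:~R]add0r !e ge_min le_max intrD.
by apply/andP; split; apply/orP; [left | right]; lra.
Qed.

Lemma circle_diffeo_int s t :
  (rho s - rho t \is a Num.int) = (s - t \is a Num.int).
Proof.
have inj := inc_inj circle_diffeo_mono.
apply/intrP/intrP => -[k e]; exists k.
  apply: (addIr t); rewrite subrK addrC; apply: inj.
  by rewrite circle_diffeoDz -e addrC subrK.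
have -> : s = t + k%:~R by rewrite -e; ring.
by rewrite circle_diffeoDz addrAC subrr add0r.
Qed.

Lemma circle_diffeo_gap s t : gap (rho s) (rho t) = gap s t.
Proof.
by apply: gap_eq => k; rewrite -circle_diffeoDz circle_diffeo_mono.
Qed.

(** The action of [rho] on representatives in [0, 1). *)
Definition circle_map t : R := rho t - (Num.floor (rho t))%:~R.

Lemma circle_map_link c d :
  link (circle_map c.1, circle_map c.2) (circle_map d.1, circle_map d.2) =
  link c d.
Proof.
rewrite /link /circle_map /= -!mulrNz !gapDr !gapDl !circle_diffeo_gap.
by ring.
Qed.

Lemma circle_map_inj s t : 0 <= s < 1 -> 0 <= t < 1 ->
  circle_map s = circle_map t -> s = t.
Proof.
move=> s01 t01 e; apply: int_unit_eq => //; rewrite -circle_diffeo_int.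
have -> : rho s - rho t = (Num.floor (rho s) - Num.floor (rho t))%:~R.
  by move: e; rewrite /circle_map intrB; lra.
exact: rpred_int.
Qed.

End CircleDiffeo.

Section PlanarIsotopic.
Variables (D E : vdiagram R) (Phi : R -> R * R -> R * R) (rho : R -> R).
Hypotheses (PhiP : ambient_isotopy Phi) (rhoP : circle_diffeo rho).
Hypothesis curveE : forall t, curve E (rho t) = Phi 1 (curve D t).
Hypothesis passE : forall t, double_param D t -> pass E (rho t) = pass D t.

Lemma isotopy_meets s t :
  meets (curve E) (rho s) (rho t) <-> meets (curve D) s t.
Proof.
rewrite /meets (circle_diffeo_int rhoP) !curveE.
have [_ _ _ _ /(_ 1)[|/bij_inj inj _]] := PhiP; first by rewrite ler01 lexx.
by split=> [[/inj]|[->]].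
Qed.

(** The chain rule, applied to the two sides of [curveE]. *)
Lemma isotopy_vel t : rho^`()%classic t *: vel E (rho t) =
  (vel D t).1 *: dx (Phi 1) (curve D t) + (vel D t).2 *: dy (Phi 1) (curve D t).
Proof.
have Phid : differentiable (Phi 1) (curve D t).
  by have [_ _ _ _ /(_ 1)[|_ /(_ (curve D t))[]]] := PhiP; rewrite ?ler01 ?lexx.
have dD : differentiable (curve D) t by apply/derivable1_diffP/curve_derivable.
have dE : differentiable (curve E) (rho t).
  by apply/derivable1_diffP/curve_derivable.
have drho : differentiable rho t by apply/derivable1_diffP; case: rhoP.
rewrite -diff_plane // /vel !derive1E' //.
have eD := congr1 (fun h : R -> R * R => h 1) (diff_comp dD Phid).
have eE := congr1 (fun h : R -> R * R => h 1) (diff_comp drho dE).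
have eDE : Phi 1 \o curve D = curve E \o rho by apply/funext => v /=.
apply: etrans eD; rewrite eDE; apply: etrans (esym eE).
have lin (a : R) : 'd (curve E) (rho t) (a *: (1 : R)) =
  a *: 'd (curve E) (rho t) (1 : R) by exact: linearZ.
apply: etrans (esym (lin ('d rho t 1))) _.
by congr ('d _ _ _); exact: mulr1.
Qed.

Lemma isotopy_left_right s t : meets (curve D) s t ->
  left_right E (rho s) (rho t) <-> left_right D s t.
Proof.
move=> [st _]; rewrite /left_right.
have rs : 0 < rho^`()%classic s by case: rhoP.
have rt : 0 < rho^`()%classic t by case: rhoP.
have dP := ambient_isotopy_det (curve D s) PhiP.
have := isotopy_vel t; have := isotopy_vel s; rewrite -st.
move: (vel E (rho s)) (vel E (rho t)) (vel D s) (vel D t) rs rt dP.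
move: (rho^`()%classic s) (rho^`()%classic t) (dx _ _) (dy _ _) => a b [x1 x2] [y1 y2].
move=> [p1 p2] [q1 q2] [v1 v2] [w1 w2] a0 b0 /=.
rewrite /det2 /= => d0 [e1 e2] [f1 f2].
have key : a * b * (p1 * q2 - p2 * q1) =
    (x1 * y2 - x2 * y1) * (v1 * w2 - v2 * w1).
  transitivity ((a * p1) * (b * q2) - (a * p2) * (b * q1)); first by ring.
  by move: e1 e2 f1 f2; rewrite /GRing.scale /= => -> -> -> ->; ring.
by rewrite -(pmulr_rgt0 (p1 * q2 - p2 * q1) (mulr_gt0 a0 b0)) key pmulr_rgt0.
Qed.

Lemma isotopy_dwrithe (n : nat) : dwrithe n D = dwrithe n E.
Proof.
have [r rD] := arrows_enum D; rewrite (dwrithe_flat _ rD).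
pose f c := (circle_map rho c.1, circle_map rho c.2).
rewrite -(@flatwrithe_map _ _ r f) => [|c d _ _]; last exact: circle_map_link.
symmetry; apply: dwrithe_flat; have [ur rP] := rD; split.
  rewrite map_inj_in_uniq // => -[c1 c2] [d1 d2] /rP[/= c101 c201 _ _ _].
  move=> /rP[/= d101 d201 _ _ _] [e1 e2].
  by rewrite (circle_map_inj rhoP c101 d101 e1) (circle_map_inj rhoP c201 d201 e2).
move=> d; split=> [/mapP[c /rP[c1 c2 m p lr] ->]|[d1 d2 m p lr]].
  apply: arrow_unit; first exact/isotopy_meets.
    by rewrite passE //; exists c.2.
  exact/isotopy_left_right.
have [s es] := circle_diffeo_surj rhoP d.1.
have [t et] := circle_diffeo_surj rhoP d.2.
rewrite -es -et in m p lr; move/isotopy_meets in m.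
rewrite passE in p; last by exists t.
move/(isotopy_left_right m) in lr.
apply/mapP; eexists; first exact/rP/(arrow_unit m p lr).
rewrite [d]surjective_pairing /f /=.
have mod v w : 0 <= w < 1 -> rho v = w ->
    w = circle_map rho (v - (Num.floor v)%:~R).
  move=> w01 e; apply: int_unit_eq => //; first exact: unit_floor.
  rewrite /circle_map -mulrNz circle_diffeoDz // e.
  rewrite opprD opprK addrA opprD addrA subrr add0r.
  by rewrite rpredD ?rpredN ?rpred_int.
by rewrite -(mod _ _ d1 es) -(mod _ _ d2 et).
Qed.

End PlanarIsotopic.
End Isotopy.

(** * Strands *)

Section PlaneDerivative.
Variable R : realType.

Lemma derive_fst (g : R -> R * R) t : derivable g t 1 ->
  'D_1 (fst \o g) t = (g^`()%classic t).1.
Proof.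
rewrite derive1E => gt; apply: cvg_lim => //.
have := cvg_comp _ fst (gt : _ --> 'D_1 g t).
by apply; exact: cvg_fst.
Qed.

Lemma derive_snd (g : R -> R * R) t : derivable g t 1 ->
  'D_1 (snd \o g) t = (g^`()%classic t).2.
Proof.
rewrite derive1E => gt; apply: cvg_lim => //.
have := cvg_comp _ snd (gt : _ --> 'D_1 g t).
by apply; exact: cvg_snd.
Qed.

End PlaneDerivative.

Section Strand.
Variable R : realType.
Implicit Types a b t u v : R.

Lemma strandB a b u v : strand a b v - strand a b u = (b - a) * (v - u) / 4.
Proof. by rewrite /strand; field. Qed.

Lemma strand_inj a b : a != b -> injective (strand a b).
Proof.
move=> ab u v uv; have /eqP := strandB a b u v.
rewrite uv subrr eq_sym mulf_eq0 invr_eq0 pnatr_eq0 orbF mulf_eq0 !subr_eq0.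
by rewrite eq_sym (negPf ab) => /eqP.
Qed.

Lemma strand_between a b u : a <= b -> -2 <= u <= 2 -> a <= strand a b u <= b.
Proof.
move=> ab u2; have ba : 0 <= b - a by rewrite subr_ge0.
have l : 0 <= (b - a) * (2 + u) by apply: mulr_ge0 => //; lra.
have r : 0 <= (b - a) * (2 - u) by apply: mulr_ge0 => //; lra.
by rewrite /strand; apply/andP; split; lra.
Qed.

Lemma strand_between_rev a b u : b <= a -> -2 <= u <= 2 ->
  b <= strand a b u <= a.
Proof.
move=> ba u2; have u2' : -2 <= - u <= 2 by lra.
by have := strand_between ba u2'; rewrite /strand opprK (addrC (_ * b)).
Qed.

Lemma strand_unit a b u : 0 < a < 1 -> 0 < b < 1 -> -2 <= u <= 2 ->
  0 < strand a b u < 1.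
Proof.
move=> a01 b01 u2; have [ab|/ltW ba] := leP a b.
  by have := strand_between ab u2; lra.
by have := strand_between_rev ba u2; lra.
Qed.

(** The inverse of [strand a b]; points of the strand are sent to [-2, 2]. *)
Definition strand_inv a b t : R := (4 * t - 2 * a - 2 * b) / (b - a).

Lemma strand_invK a b t : a != b -> strand a b (strand_inv a b t) = t.
Proof.
move=> ab; have ba : b - a != 0 by rewrite subr_eq0 eq_sym.
by rewrite /strand /strand_inv; field.
Qed.

Lemma strandK a b u : a != b -> strand_inv a b (strand a b u) = u.
Proof.
move=> ab; have ba : b - a != 0 by rewrite subr_eq0 eq_sym.
by rewrite /strand /strand_inv; field.
Qed.

Lemma strandP a b t : a != b ->
  (exists2 u, -2 <= u <= 2 & t = strand a b u) <-> (t - a) * (t - b) <= 0.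
Proof.
move=> ab; have e u : (strand a b u - a) * (strand a b u - b) =
    - ((4 - u ^+ 2) * ((b - a) / 4) ^+ 2) by rewrite /strand; field.
have ba : 0 < ((b - a) / 4) ^+ 2.
  by rewrite exprn_even_gt0 //= mulf_neq0 ?invr_eq0 ?pnatr_eq0 // subr_eq0 eq_sym.
split=> [[u u2 ->]|]; first by rewrite e oppr_le0 mulr_ge0 ?(ltW ba) //; nra.
rewrite -{1 2}(strand_invK t ab) e oppr_le0 pmulr_lge0 // => u2.
by exists (strand_inv a b t); rewrite ?strand_invK //; nra.
Qed.

(** A point off a strand is on the same side of all its points. *)
Lemma strand_side a b t u : -2 <= u <= 2 -> 0 < (t - a) * (t - b) ->
  (t < strand a b u) = (t < a) /\ (strand a b u < t) = (a < t).
Proof.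
move=> u2 tab; have S : a <= strand a b u <= b \/ b <= strand a b u <= a.
  have [ab|/ltW ba] := leP a b; first by left; exact: strand_between.
  by right; exact: strand_between_rev.
have [ta|ta] := ltP t a.
  have tb : t < b by rewrite -subr_lt0; move: tab; rewrite nmulr_rgt0 // subr_lt0.
  have lt_t : t < strand a b u by case: S; lra.
  by rewrite lt_t ltNge (ltW lt_t) ltNge (ltW ta).
have at_ : a < t.
  rewrite lt_neqAle ta andbT; apply/eqP => e.
  by move: tab; rewrite e subrr mul0r ltxx.
have tb : b < t.
  by rewrite -subr_gt0; move: tab; rewrite pmulr_rgt0 // subr_gt0.
have lt_t : strand a b u < t by case: S; lra.
by rewrite lt_t at_ ltNge (ltW lt_t).
Qed.

End Strand.

Section Strands.
Variables (R : realType) (k : nat) (a b : 'I_k -> R).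
Hypothesis abP : forall i, [/\ 0 < a i < 1, 0 < b i < 1 & a i != b i].
Hypothesis ab_disjoint : forall i j u v, -2 <= u <= 2 -> -2 <= v <= 2 ->
  strand (a i) (b i) u = strand (a j) (b j) v -> i = j.
Implicit Types (p : 'I_k * R) (t : R).

(** A point of a strand, at the parameter [p.2] of the strand [p.1]. *)
Definition spoint p : R := strand (a p.1) (b p.1) p.2.

(** Parameters of strands range over [-2, 2]. *)
Definition in_range p : bool := -2 <= p.2 <= 2.

Definition outside t : Prop :=
  forall i u, -2 <= u <= 2 -> t <> strand (a i) (b i) u.

Lemma spoint_unit p : in_range p -> 0 <= spoint p < 1.
Proof.
move=> pr; have [a01 b01 _] := abP p.1.
by have /andP[/ltW -> ->] := strand_unit a01 b01 pr.
Qed.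

Lemma spoint_inj : {in in_range &, injective spoint}.
Proof.
move=> [i u] [j v] iu jv e; have ij := ab_disjoint iu jv e.
rewrite /= in ij; subst j; have [_ _ abi] := abP i.
by have /= -> := strand_inj abi e.
Qed.

(** Being outside the strands is an open condition. *)
Lemma outsideP t : outside t <-> forall i, 0 < (t - a i) * (t - b i).
Proof.
split=> [ot i|ot i u u2 e].
  rewrite ltNge; apply/negP; have [_ _ abi] := abP i.
  by move=> /(strandP t abi)[u u2 /ot]; apply.
have [_ _ abi] := abP i; have : (t - a i) * (t - b i) <= 0.
  by apply/(strandP t abi); exists u.
by rewrite leNgt ot.
Qed.

Lemma not_outside t : ~ outside t -> exists2 p, in_range p & t = spoint p.
Proof.
move=> nt; apply: contrapT => np; apply: nt => i u u2 e.
by apply: np; exists (i, u).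
Qed.

Lemma gap_side t i u v : 0 <= t < 1 -> 0 < (t - a i) * (t - b i) ->
  -2 <= u <= 2 -> -2 <= v <= 2 ->
  gap t (spoint (i, u)) = gap t (spoint (i, v)) /\
  gap (spoint (i, u)) t = gap (spoint (i, v)) t.
Proof.
move=> t01 ti u2 v2; rewrite !gap_unit ?spoint_unit // /spoint /=.
by have [-> ->] := strand_side u2 ti; have [-> ->] := strand_side v2 ti.
Qed.

Lemma gap_outside t i u v : 0 <= t < 1 -> outside t ->
  -2 <= u <= 2 -> -2 <= v <= 2 ->
  gap t (spoint (i, u)) = gap t (spoint (i, v)) /\
  gap (spoint (i, u)) t = gap (spoint (i, v)) t.
Proof. by move=> t01 /outsideP ot; apply: gap_side. Qed.

Lemma gap_same i u v : -2 <= u <= 2 -> -2 <= v <= 2 ->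
  gap (spoint (i, u)) (spoint (i, v)) = (0 < (b i - a i) * (v - u))%R%:Z.
Proof.
move=> u2 v2; rewrite gap_unit ?spoint_unit // -subr_gt0 strandB.
by rewrite pmulr_lgt0 // invr_gt0 ltr0n.
Qed.

(** Distinct strands are disjoint intervals, so the relative position of a point
    of one and a point of another depends on the two strands only. *)
Lemma gap_cross : exists G : 'I_k -> 'I_k -> int,
  (forall i j u v, i != j -> -2 <= u <= 2 -> -2 <= v <= 2 ->
     gap (spoint (i, u)) (spoint (j, v)) = G i j) /\
  (forall i j, i != j -> G i j + G j i = 1).
Proof.
have r0 : -2 <= (0 : R) <= 2 by lra.
exists (fun i j => gap (spoint (i, 0)) (spoint (j, 0))); split.
  have out i j u : i != j -> -2 <= u <= 2 ->
      0 < (spoint (j, u) - a i) * (spoint (j, u) - b i).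
    move=> ij u2; rewrite ltNge; apply/negP; have [_ _ abi] := abP i.
    move=> /(strandP _ abi)[v v2 e].
    by move: ij; rewrite (ab_disjoint v2 u2 (esym e)) eqxx.
  move=> i j u v ij u2 v2.
  have [_ ->] := gap_side (spoint_unit (p := (j, v)) v2) (out i j v ij v2) u2 r0.
  rewrite eq_sym in ij.
  by have [-> _] := gap_side (spoint_unit (p := (i, 0)) r0) (out j i 0 ij r0) v2 r0.
move=> i j ij; rewrite !gap_unit ?spoint_unit //.
case: ltgtP => // /spoint_inj - /(_ r0 r0)[e].
by rewrite e eqxx in ij.
Qed.

End Strands.

(** * Local changes *)

(** The same crossing, or arrow, with its ends exchanged. *)
Definition flip (T : Type) (c : T * T) : T * T := (c.2, c.1).

(** The two points [q.1] and [q.2] of the strands [sigma] form a crossing, of a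
    kind selected by [cl]. *)
Definition crossing (R : realType) (k : nat) (sigma : 'I_k -> R -> R * R)
    (cl : 'I_k -> 'I_k -> bool) (q : ('I_k * R) * ('I_k * R)) : Prop :=
  [/\ in_range q.1, in_range q.2, sigma q.1.1 q.1.2 = sigma q.2.1 q.2.2,
      q.1 != q.2 & cl q.1.1 q.2.1].

(** Each crossing is listed exactly once, in one of its two orders. *)
Definition crossing_list (R : realType) (k : nat) (sigma : 'I_k -> R -> R * R)
    (cl : 'I_k -> 'I_k -> bool) (L : seq (('I_k * R) * ('I_k * R))) : Prop :=
  [/\ uniq (L ++ map (@flip _) L), forall q, q \in L -> crossing sigma cl q
    & forall q, crossing sigma cl q -> q \in L \/ flip q \in L].

Section OneSide.
Variables (R : realType) (k : nat) (B : set (R * R)).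
Variables (sigma tau : 'I_k -> R -> R * R) (a b : 'I_k -> R).
Variables (D E : vdiagram R).
Hypothesis DE : local_change B sigma tau a b D E.
Hypothesis sigmaB : forall i u, -2 <= u <= 2 -> B (sigma i u).
Implicit Types (p : 'I_k * R) (q : ('I_k * R) * ('I_k * R)) (s t u v : R).

Let abP i : [/\ 0 < a i < 1, 0 < b i < 1 & a i != b i].
Proof. by case: DE. Qed.

Let ab_disjoint i j u v : -2 <= u <= 2 -> -2 <= v <= 2 ->
  strand (a i) (b i) u = strand (a j) (b j) v -> i = j.
Proof. by case: DE => _ H _ _; apply: H. Qed.

Local Notation point := (spoint a b).
Local Notation out := (outside a b).

Lemma curve_spoint p : in_range p -> curve D (point p) = sigma p.1 p.2.
Proof. by case: DE => _ _ H _ pr; have [] := H p.1 _ pr. Qed.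

Lemma outside_meets s t : 0 <= s < 1 -> 0 <= t < 1 -> meets (curve D) s t ->
  out s -> out t.
Proof.
move=> s01 t01 [st _] os; apply: contrapT => /not_outside[p pr tp].
have [_ _ _ /(_ s s01 os)[+ _ _]] := DE; apply.
by rewrite st tp curve_spoint //; apply: sigmaB.
Qed.

(** Near [t = 0], a parameter [x < 0] is replaced by [x + 1], which lies beyond
    all strands as well. *)
Lemma outside_curve_near t : 0 <= t < 1 -> out t ->
  \forall x \near t, curve D x = curve E x.
Proof.
move=> t01 ot; have [_ _ _ H] := DE.
have eDE x : 0 <= x < 1 -> out x -> curve D x = curve E x.
  by move=> x01 /(H _ x01)[].
have pos (c : R) y : out y -> \forall x \near y, out x.
  move=> /(outsideP abP) oy.
  have : \forall x \near y, forall i, 0 < (x - a i) * (x - b i).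
    have := @filter_forall R _ (fun i x => 0 < (x - a i) * (x - b i)) (nbhs y) _.
    apply=> i.
    have : (x - a i) * (x - b i) @[x --> y] --> (y - a i) * (y - b i).
      by apply: cvgM; apply: cvgB; [exact: cvg_id | exact: cvg_cst
        | exact: cvg_id | exact: cvg_cst].
    by move=> /cvgr_gt; apply; exact: oy.
  by apply: filterS => x ox; apply/(outsideP abP).
have lt1 : \forall x \near t, x < 1 by apply: lt_nbhsl; lra.
have [t0|t0] := ltP 0 t.
  have gt0 : \forall x \near t, 0 < x by exact: lt_nbhsr.
  near=> x; apply: eDE; last by near: x; exact: pos.
  by apply/andP; split; [apply: ltW; near: x | near: x].
have {}t0 : t = 0 by lra.
have o1 : out (0 + 1).
  by move=> i u u2; have [a01 b01 _] := abP i;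
    have := strand_unit a01 b01 u2; lra.
have o1x : \forall x \near t, out (x + 1).
  have : x + 1 @[x --> t] --> t + 1 by apply: cvgD; [exact: cvg_id | exact: cvg_cst].
  by apply; rewrite t0; exact: pos.
have gtN1 : \forall x \near t, -1 < x by apply: lt_nbhsr; lra.
near=> x; have [x0|x0] := leP 0 x.
  apply: eDE; last by near: x; exact: pos.
  by rewrite x0 /=; near: x.
rewrite -(curve_periodic D) -(curve_periodic E); apply: eDE; last by near: x.
have : -1 < x by near: x.
by lra.
Unshelve. all: by end_near.
Qed.

Lemma outside_vel t : 0 <= t < 1 -> out t -> vel D t = vel E t.
Proof.
move=> t01 ot; rewrite /vel !derive1E; apply: near_eq_derive.
exact: outside_curve_near.
Qed.

(** Both sides of a local change have the same arrows outside the strands. *)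
Lemma outside_arrow c : arrows D c -> out c.1 -> arrows E c.
Proof.
case=> c1 c2 m p lr o1; have o2 := outside_meets c1 c2 m o1.
have [_ _ _ H] := DE; have [_ e1 p1] := H _ c1 o1; have [_ e2 _] := H _ c2 o2.
split; [exact: c1 | exact: c2 | | |].
- by case: m => m mi; split; [rewrite e1 e2 | exact: mi].
- by rewrite p1 //; exists c.2.
- by rewrite /left_right -(outside_vel c1 o1) -(outside_vel c2 o2).
Qed.

(** The strand [i] is run through at speed [4 / (b i - a i)]. *)
Lemma strand_derive (f g : R -> R) i u (l : R) : -2 < u < 2 ->
  (forall v, -2 <= v <= 2 -> f (strand (a i) (b i) v) = g v) ->
  is_derive u 1 g l ->
  'D_1 f (strand (a i) (b i) u) = l * (4 / (b i - a i)).
Proof.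
move=> u2 fg gl; have [_ _ abi] := abP i.
pose m := strand_inv (a i) (b i).
have mE : m = (fun t => (4 / (b i - a i)) * t - (2 * a i + 2 * b i) / (b i - a i)).
  apply/funext => t; rewrite /m /strand_inv.
  have ba : b i - a i != 0 by rewrite subr_eq0 eq_sym.
  by field.
have md t : is_derive t 1 m (4 / (b i - a i)).
  rewrite mE; apply: is_derive_eq.
by rewrite subr0; exact: mulr1.
have mc : {for strand (a i) (b i) u, continuous m}.
  apply/differentiable_continuous/derivable1_diffP.
  by have [] := md (strand (a i) (b i) u).
have mu : m (strand (a i) (b i) u) = u by exact: strandK.
rewrite (@near_eq_derive _ _ _ _ (g \o m)); last first.
  have m1 : \forall x \near strand (a i) (b i) u, -2 < m x.
    by move: mc => /cvgr_gt; apply; rewrite mu; lra.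
  have m2 : \forall x \near strand (a i) (b i) u, m x < 2.
    by move: mc => /cvgr_lt; apply; rewrite mu; lra.
  near=> x; rewrite /= -fg ?strand_invK //.
  by apply/andP; split; apply: ltW; near: x.
apply: derive_val; apply: is_derive1_comp; rewrite ?mu //.
Unshelve. all: by end_near.
Qed.

Lemma vel_spoint p (x y : R) : -2 < p.2 < 2 ->
  is_derive p.2 1 (fun u => (sigma p.1 u).1) x ->
  is_derive p.2 1 (fun u => (sigma p.1 u).2) y ->
  vel D (point p) = (x * (4 / (b p.1 - a p.1)), y * (4 / (b p.1 - a p.1))).
Proof.
move=> p2 dx dy; rewrite [vel _ _]surjective_pairing /vel.
rewrite -(derive_fst (@curve_derivable _ D _)) -(derive_snd (@curve_derivable _ D _)).
have e v : -2 <= v <= 2 -> curve D (strand (a p.1) (b p.1) v) = sigma p.1 v.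
  by move=> v2; rewrite -(@curve_spoint (p.1, v)).
by congr (_, _); apply: strand_derive => // v /e /= ->.
Qed.

Lemma left_right_spoint p p' (x y x' y' : R) : -2 < p.2 < 2 -> -2 < p'.2 < 2 ->
  is_derive p.2 1 (fun u => (sigma p.1 u).1) x ->
  is_derive p.2 1 (fun u => (sigma p.1 u).2) y ->
  is_derive p'.2 1 (fun u => (sigma p'.1 u).1) x' ->
  is_derive p'.2 1 (fun u => (sigma p'.1 u).2) y' ->
  left_right D (point p) (point p') <->
  0 < (b p.1 - a p.1) * (b p'.1 - a p'.1) * (x * y' - y * x').
Proof.
move=> p2 p2' dx dy dx' dy'; rewrite /left_right.
rewrite (vel_spoint p2 dx dy) (vel_spoint p2' dx' dy') /det2 /=.
have [_ _ ab] := abP p.1; have [_ _ ab'] := abP p'.1.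
have ba : b p.1 - a p.1 != 0 by rewrite subr_eq0 eq_sym.
have ba' : b p'.1 - a p'.1 != 0 by rewrite subr_eq0 eq_sym.
set d := b p.1 - _ in ba *; set d' := b p'.1 - _ in ba' *.
have -> : x * (4 / d) * (y' * (4 / d')) - y * (4 / d) * (x' * (4 / d')) =
    (4 / (d * d')) ^+ 2 * (d * d' * (x * y' - y * x')) by field; apply/andP.
rewrite pmulr_rgt0 // exprn_even_gt0 //= mulf_neq0 ?pnatr_eq0 //.
by rewrite invr_eq0 mulf_neq0.
Qed.

(** * Arrows between strands *)

(** The two parameters on the circle of the crossing [q]. *)
Definition spoints q : R * R := (point q.1, point q.2).

(** The arrow at the crossing [q], directed from left to right. *)
Definition arrow_of q : R * R :=
  if `[< left_right D (point q.1) (point q.2) >] then spoints q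
  else flip (spoints q).

Variables (cl : 'I_k -> 'I_k -> bool) (L : seq (('I_k * R) * ('I_k * R))).
Hypothesis sigmaL : crossing_list sigma cl L.
Hypothesis passD : forall i j u v, -2 <= u <= 2 -> -2 <= v <= 2 ->
  meets (curve D) (strand (a i) (b i) u) (strand (a j) (b j) v) ->
  pass D (strand (a i) (b i) u) <> Virt <-> cl i j.

Lemma spoint_meets p p' : in_range p -> in_range p' -> p != p' ->
  sigma p.1 p.2 = sigma p'.1 p'.2 -> meets (curve D) (point p) (point p').
Proof.
move=> pr pr' pp' e; split; first by rewrite !curve_spoint.
apply/negP => /int_unit_eq e'; case/eqP: pp'.
by apply: (spoint_inj abP ab_disjoint) => //; apply: e'; exact: spoint_unit.
Qed.

Lemma arrow_of_arrow q : q \in L -> arrows D (arrow_of q).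
Proof.
have [_ H _] := sigmaL; move=> /H[r1 r2 e ne clq].
have m := spoint_meets r1 r2 ne e.
have p1 : pass D (point q.1) <> Virt by apply/(passD r1 r2 m).
rewrite /arrow_of; case: asboolP => lr.
  by split; [exact: spoint_unit | exact: spoint_unit | exact: m | exact: p1
    | exact: lr].
split; [exact: spoint_unit | exact: spoint_unit | exact: meets_sym
  | exact: pass_meets p1 |].
by case: (left_right_total m) => [/lr[]|lr']; exact: lr'.
Qed.

Lemma inner_arrow c : arrows D c -> ~ out c.1 -> c \in map arrow_of L.
Proof.
move=> [c1 c2 m pc lr] o1.
have [p pr ep] := not_outside o1.
have [p' pr' ep'] : exists2 p', in_range p' & c.2 = point p'.
  apply: not_outside => o2; apply: o1.
  exact: outside_meets (meets_sym m) o2.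
case: c c1 c2 m pc lr o1 ep ep' => [x y] /= _ _ m pc lr _ ex ey.
rewrite ex ey in m pc lr *.
have ne : p != p'.
  apply/eqP => e; case: m => _; rewrite e subrr.
  by rewrite rpred0.
have [_ _ H] := sigmaL; case: (H (p, p')) => [|qL|qL].
- split=> //=; first by case: m; rewrite !curve_spoint.
  exact/(passD pr pr' m).
- by apply/mapP; exists (p, p') => //; rewrite /arrow_of asboolT.
- apply/mapP; exists (p', p) => //; rewrite /arrow_of asboolF //=.
  exact: left_right_asym.
Qed.

Lemma arrow_of_inj : {in L &, injective arrow_of}.
Proof.
have [uL H _] := sigmaL; move=> q q' qL q'L.
have [r1 r2 _ _ _] := H _ qL; have [r1' r2' _ _ _] := H _ q'L.
have inj := spoint_inj abP ab_disjoint.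
have nflip : q = flip q' -> False.
  move=> e; move: uL; rewrite cat_uniq => /and3P[_ /hasPn/(_ q) + _].
  by rewrite qL e map_f // => /(_ isT).
have E1 x : arrow_of x = spoints x \/ arrow_of x = flip (spoints x).
  by rewrite /arrow_of; case: asboolP => _; [left | right].
case: q q' qL q'L r1 r2 r1' r2' nflip => [q1 q2] [q1' q2'] _ _ /=.
move=> r1 r2 r1' r2' nflip.
have [->|->] := E1 (q1, q2); have [->|->] := E1 (q1', q2') => -[e1 e2].
- by rewrite (inj _ _ r1 r1' e1) (inj _ _ r2 r2' e2).
- by case: nflip; rewrite (inj _ _ r1 r2' e1) (inj _ _ r2 r1' e2).
- by case: nflip; rewrite (inj _ _ r2 r1' e1) (inj _ _ r1 r2' e2).
- by rewrite (inj _ _ r2 r2' e1) (inj _ _ r1 r1' e2).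
Qed.

(** A diagram has the arrows of its strands, and those away from the strands. *)
Lemma inner_outer_enum (s0 : seq (R * R)) : uniq s0 ->
  (forall c, c \in s0 <-> arrows D c /\ out c.1) ->
  enumerates (map arrow_of L ++ s0) (arrows D).
Proof.
move=> us0 s0P; split.
  rewrite cat_uniq us0 map_inj_in_uniq ?andbT; last exact: arrow_of_inj.
  have [uL H _] := sigmaL; move: uL; rewrite cat_uniq => /andP[-> _] /=.
  apply/hasPn => c /s0P[_ oc]; apply/mapP => -[q qL cq].
  have [r1 r2 _ _ _] := H _ qL.
  move: oc; rewrite cq /arrow_of; case: asboolP => _ /=.
    by move=> /(_ q.1.1 q.1.2 r1); apply.
  by move=> /(_ q.2.1 q.2.2 r2); apply.
move=> c; rewrite mem_cat; split.
  by case/orP=> [/mapP[q qL ->]|/s0P[]//]; exact: arrow_of_arrow.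
move=> cD; have [oc|oc] := pselect (out c.1).
  by apply/orP; right; apply/s0P.
by rewrite inner_arrow.
Qed.

End OneSide.

Lemma local_change_sym (R : realType) (k : nat) (B : set (R * R))
    (sigma tau : 'I_k -> R -> R * R) (a b : 'I_k -> R) (D E : vdiagram R) :
  (forall i u, -2 <= u <= 2 -> B (tau i u)) ->
  local_change B sigma tau a b D E -> local_change B tau sigma a b E D.
Proof.
move=> tauB [abP dis st H]; split=> // [i u u2|t t01 ot].
  by have [] := st i u u2.
have [nB eE eP] := H t t01 ot; rewrite eE; split=> // -[u [tu tui]].
rewrite eP //.
pose w := u - (Num.floor u)%:~R.
have Ew : curve E w = curve D t by rewrite -eE tu /w -mulrNz curveDz.
have ow i v : -2 <= v <= 2 -> w <> strand (a i) (b i) v.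
  move=> v2 e; apply: nB; rewrite -Ew e; have [_ ->] := st i v v2.
  exact: tauB.
have [_ eW _] := H w (unit_floor u) ow.
exists w; split; first by rewrite -eW Ew.
have -> : t - w = t - u + (Num.floor u)%:~R by rewrite /w; ring.
by rewrite rpredDr ?rpred_int.
Qed.

Section TwoSides.
Variables (R : realType) (k : nat) (B : set (R * R)).
Variables (sigma tau : 'I_k -> R -> R * R).
Variables (w : 'I_k -> 'I_k -> passage -> Prop) (cl : 'I_k -> 'I_k -> bool).
Variables (L M : seq (('I_k * R) * ('I_k * R))).
Hypothesis sigmaB : forall i u, -2 <= u <= 2 -> B (sigma i u).
Hypothesis tauB : forall i u, -2 <= u <= 2 -> B (tau i u).
Hypothesis sigmaL : crossing_list sigma cl L.
Hypothesis tauM : crossing_list tau cl M.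
Hypothesis wP : forall i j p, w i j p -> p <> Virt <-> cl i j.

(** The two sides of a move have the same arrows [s0] away from the strands, so
    that only the arrows of the strands are to be compared.  The relation [cl]
    tells which strands cross classically. *)
Lemma tangle_move_dwrithe (D E : vdiagram R) (n : nat) :
  tangle_move B sigma tau w D E ->
  exists a b s0,
    [/\ local_change B sigma tau a b D E, local_change B tau sigma a b E D,
        forall c, c \in s0 -> [/\ 0 <= c.1 < 1, 0 <= c.2 < 1,
                                outside a b c.1 & outside a b c.2],
        dwrithe n D = flatwrithe n%:Z (map (arrow_of a b D) L ++ s0)
      & dwrithe n E = flatwrithe n%:Z (map (arrow_of a b E) M ++ s0)].
Proof.
move=> [a [b [DE wD wE]]]; have ED := local_change_sym tauB DE.
have [r [ur rD]] := arrows_enum D.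
pose s0 := [seq c <- r | `[< outside a b c.1 >]].
have s0D c : c \in s0 <-> arrows D c /\ outside a b c.1.
  rewrite mem_filter; split; first by case/andP=> /asboolP ? /rD.
  by case=> /rD -> /asboolP ->.
have s0E c : c \in s0 <-> arrows E c /\ outside a b c.1.
  split=> [/s0D[cD oc]|[cE oc]].
    by split; [exact: (outside_arrow DE sigmaB cD oc) | exact: oc].
  by apply/s0D; split; [exact: (outside_arrow ED tauB cE oc) | exact: oc].
have us0 : uniq s0 by exact: filter_uniq.
exists a, b, s0; split; [exact: DE | exact: ED | | |].
- move=> c /s0D[[c1 c2 m _ _] oc]; split=> //.
  exact: (outside_meets DE sigmaB c1 c2 m oc).
- apply: dwrithe_flat; apply: (inner_outer_enum DE sigmaB sigmaL _ us0 s0D).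
  by move=> i j u v u2 v2 /(wD _ _ _ _ u2 v2)/wP.
- apply: dwrithe_flat; apply: (inner_outer_enum ED tauB tauM _ us0 s0E).
  by move=> i j u v u2 v2 /(wE _ _ _ _ u2 v2)/wP.
Qed.

End TwoSides.

(** A part of the crossings of the strands, selected by a symmetric relation. *)
Lemma crossing_list_filter (R : realType) (k : nat) (sigma : 'I_k -> R -> R * R)
    (cl : rel 'I_k) L : symmetric cl ->
  crossing_list sigma (fun _ _ => true) L ->
  crossing_list sigma cl [seq q <- L | cl q.1.1 q.2.1].
Proof.
move=> clC [uL LP H]; split.
- apply: subseq_uniq uL; apply: cat_subseq; first exact: filter_subseq.
  exact: map_subseq (filter_subseq _ _).
- by move=> q; rewrite mem_filter => /andP[clq /LP[]].
move=> q [r1 r2 e ne clq]; have clq' : cl q.2.1 q.1.1 by rewrite clC.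
by rewrite !mem_filter /= clq clq' /=; apply: H; split.
Qed.

(** * The hill function and the boxes *)

(* The three strands of a triangle; the last one is the one that moves. *)
Local Notation tri0 := (ord0 : 'I_3).
Local Notation tri1 := (Ordinal (isT : (1 < 3)%N)).
Local Notation tri2 := (ord_max : 'I_3).

Section HillAndStrands.
Variable R : realType.
Implicit Types u v : R.

Lemma is_derive_hill u :
  is_derive u 1 (@hill R) (- (4 * u * (4 - u ^+ 2)) / 9).
Proof.
have -> : @hill R = (fun x => (4 - x * x) * (4 - x * x) * 9^-1).
  by apply/funext => x; rewrite /hill; field.
apply: is_derive_eq.
by rewrite /GRing.scale /=; field.
Qed.

Lemma hillN u : hill (- u) = hill u.
Proof. by rewrite /hill sqrrN. Qed.

(** The quartic equation [9 u = (4 - u^2)^2] has the only root 1 in [-2, 2]. *)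
Lemma hill_fixpoint u : -2 <= u <= 2 -> hill u = u -> u = 1.
Proof.
move=> u2 hu; have u0 : 0 <= u.
  by rewrite -hu /hill divr_ge0 // sqr_ge0.
have e9 : (4 - u ^+ 2) ^+ 2 = 9 * u by rewrite -{2}hu /hill; field.
have /eqP : (u - 1) * (u ^+ 3 + u ^+ 2 - 7 * u - 16) = 0.
  by transitivity ((4 - u ^+ 2) ^+ 2 - 9 * u); [ring | rewrite e9 subrr].
rewrite mulf_eq0 => /orP[|/eqP]; first by rewrite subr_eq0 => /eqP.
have -> : u ^+ 3 = u * u ^+ 2 by ring.
have u4 : u ^+ 2 <= 4 by nra.
have : u * u ^+ 2 <= u * 4 by rewrite ler_wpM2l.
by lra.
Qed.

Lemma hill_eq1 u : -2 <= u <= 2 -> hill u = 1 -> u = 1 \/ u = -1.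
Proof.
move=> u2 hu; have : (u ^+ 2 - 1) * (7 - u ^+ 2) = 0.
  have {}hu : (4 - u ^+ 2) ^+ 2 = 9.
    by transitivity (9 * hill u); [rewrite /hill; field | rewrite hu mulr1].
  by transitivity (9 - (4 - u ^+ 2) ^+ 2); [ring | rewrite hu subrr].
move/eqP; rewrite mulf_eq0 => /orP[|/eqP e]; last by nra.
have -> : u ^+ 2 - 1 = (u - 1) * (u + 1) by ring.
by rewrite mulf_eq0 subr_eq0 addr_eq0 => /orP[/eqP|/eqP]; auto.
Qed.

Lemma hill_bound u : -2 <= u <= 2 -> 0 <= hill u <= 2.
Proof.
move=> u2; have u4 : 0 <= u ^+ 2 <= 4 by rewrite sqr_ge0 /=; nra.
rewrite /hill; move: (u ^+ 2) u4 => x x4.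
by rewrite divr_ge0 ?sqr_ge0 //= ler_pdivrMr //; nra.
Qed.

Lemma kink_box (i : 'I_1) u : -2 <= u <= 2 -> @box1 R (kink i u).
Proof.
move=> u2; have u4 : 0 <= u ^+ 2 <= 4 by rewrite sqr_ge0 /=; nra.
rewrite /box1 /box /kink /=; have -> : u ^+ 3 = u * u ^+ 2 by ring.
by move: (u ^+ 2) u4 => x x4; apply/andP; split; apply/andP; split; nra.
Qed.

Lemma unkink_box (i : 'I_1) u : -2 <= u <= 2 -> @box1 R (unkink i u).
Proof.
move=> u2; have u4 : 0 <= u ^+ 2 <= 4 by rewrite sqr_ge0 /=; nra.
rewrite /box1 /box /unkink /=.
have -> : u ^+ 3 - u + u * hill u = u * (u ^+ 2 - 1 + hill u) by ring.
rewrite /hill; move: (u ^+ 2) u4 => x x4.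
have : 0 <= x - 1 + (4 - x) ^+ 2 / 9 <= 3 by apply/andP; split; nra.
by move: (x - 1 + _) => y y3; apply/andP; split; apply/andP; split; nra.
Qed.

Lemma bigon_box (i : 'I_2) u : -2 <= u <= 2 -> @box2 R (bigon i u).
Proof.
by move=> u2; have := hill_bound u2; rewrite /box2 /box /bigon;
  case: ifP => _ /= h; apply/andP; split; lra.
Qed.

Lemma unbigon_box (i : 'I_2) u : -2 <= u <= 2 -> @box2 R (unbigon i u).
Proof.
by move=> u2; rewrite /box2 /box /unbigon; case: ifP => _ /=; apply/andP; split; lra.
Qed.

Lemma upper_triangle_box (i : 'I_3) u : -2 <= u <= 2 ->
  @box2 R (upper_triangle i u).
Proof.
by move=> u2; have := hill_bound u2; rewrite /box2 /box /upper_triangle;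
  case: i => -[|[|[|//]]] ? /= h; apply/andP; split; lra.
Qed.

(** The half-turn about the origin exchanges the two triangles. *)
Lemma lower_triangleE (i : 'I_3) u :
  lower_triangle i u = - upper_triangle i (- u).
Proof.
rewrite /lower_triangle.
transitivity (- (upper_triangle i (- u)).1, - (upper_triangle i (- u)).2) => //.
by rewrite /upper_triangle hillN; case: i => -[|[|[|//]]] ? /=; rewrite ?opprK.
Qed.

Lemma lower_triangle_box (i : 'I_3) u : -2 <= u <= 2 ->
  @box2 R (lower_triangle i u).
Proof.
move=> u2; rewrite lower_triangleE.
have : -2 <= - u <= 2 by lra.
move=> /(upper_triangle_box i); rewrite /box2 /box /=; lra.
Qed.

(** * Crossings of the strands *)

(** The crossing of the kink. *)
Definition kink_crossings : seq (('I_1 * R) * ('I_1 * R)) :=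
  [:: ((ord0, 1), (ord0, -1))].

Lemma kink_crossing_list : crossing_list (@kink R) (fun _ _ => true) kink_crossings.
Proof.
have n1 : (1 == -1 :> R) = false by apply/eqP; lra.
split.
- by rewrite /= !inE !xpair_eqE n1.
- move=> q; rewrite inE => /eqP ->.
  split; rewrite /in_range //= ?xpair_eqE ?n1 //; [lra | lra |].
  by rewrite /kink; congr (_, _); ring.
move=> [[i u] [j v]] [/= _ _ [e3 e2] ne _].
rewrite (ord1 i) (ord1 j) in ne *.
have uv : u = - v.
  have : (u - v) * (u + v) = 0 by rewrite -subr_sqr e2 subrr.
  move/eqP; rewrite mulf_eq0 subr_eq0 addr_eq0 => /orP[/eqP e|/eqP //].
  by rewrite e eqxx in ne.
have v0 : v != 0.
  by apply: contra ne => /eqP v0; rewrite uv v0 oppr0.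
have : v * ((v - 1) * (v + 1)) = 0.
  transitivity (((v ^+ 3 - v) - (u ^+ 3 - u)) / 2); first by rewrite uv; field.
  by rewrite e3 subrr mul0r.
move/eqP; rewrite !mulf_eq0 (negPf v0) subr_eq0 addr_eq0 /=.
case/orP=> /eqP ev; rewrite uv ev ?opprK.
  by right; rewrite inE.
by left; rewrite inE.
Qed.

Lemma unkink_crossing_list : crossing_list (@unkink R) (fun _ _ => true) [::].
Proof.
split=> // -[[i u] [j v]] [/= _ _ [e3 e2] ne _].
rewrite (ord1 i) (ord1 j) in ne *.
case/eqP: ne; congr (_, _).
have /eqP : (u - v) * (u + v) = 0 by rewrite -subr_sqr e2 subrr.
rewrite mulf_eq0 subr_eq0 addr_eq0 => /orP[/eqP //|/eqP uv].
have pos : 0 < v ^+ 2 - 1 + hill v.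
  have -> : v ^+ 2 - 1 + hill v = ((v ^+ 2) ^+ 2 + v ^+ 2 + 7) / 9.
    by rewrite /hill; field.
  have := sqr_ge0 v; have := sqr_ge0 (v ^+ 2); lra.
have /eqP : v * (v ^+ 2 - 1 + hill v) = 0.
  transitivity (((v ^+ 3 - v + v * hill v) - (u ^+ 3 - u + u * hill u)) / 2).
    by rewrite uv hillN; field.
  by rewrite e3 subrr mul0r.
by rewrite mulf_eq0 (gt_eqF pos) orbF => /eqP v0; rewrite uv v0 oppr0.
Qed.

(** The corners of the bigon. *)
Definition bigon_crossings : seq (('I_2 * R) * ('I_2 * R)) :=
  [:: ((ord0, 1), (ord_max, 1)); ((ord0, -1), (ord_max, -1))].

Lemma bigon_crossing_list :
  crossing_list (@bigon R) (fun _ _ => true) bigon_crossings.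
Proof.
have n1 : (1 == -1 :> R) = false by apply/eqP; lra.
have h1 : hill (1 : R) = 1 by rewrite /hill; field.
split.
- by rewrite /= !inE !xpair_eqE -!val_eqE /= n1.
- move=> q; rewrite !inE => /orP[] /eqP ->;
    split; rewrite /in_range //=; first [by rewrite /bigon /= ?hillN h1 subrr | lra].
move=> [[i u] [j v]] [/= u2 _ e ne _]; rewrite /in_range /= in u2.
have uv : u = v by move: e; rewrite /bigon; do 2!case: ifP => _; case.
rewrite -{v}uv in e ne *.
have I2 (x : 'I_2) : x = ord0 \/ x = ord_max.
  by case: x => -[|[|//]] x2; [left | right]; exact/val_inj.
have done h : hill u = 1 -> ((ord0, u), (ord_max, u)) \in bigon_crossings.
  by move=> /(hill_eq1 u2)[->|->]; rewrite !inE !eqxx ?orbT.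
have [ei|ei] := I2 i; have [ej|ej] := I2 j; rewrite ei ej in e ne *.
- by rewrite eqxx in ne.
- by left; apply: done; case: e => /esym/eqP; rewrite subr_eq0 => /eqP.
- by right; apply: done; case: e => /eqP; rewrite subr_eq0 => /eqP.
- by rewrite eqxx in ne.
Qed.

Lemma unbigon_crossing_list : crossing_list (@unbigon R) (fun _ _ => true) [::].
Proof.
split=> // -[[i u] [j v]] [/= _ _ + + _]; rewrite /unbigon.
case: eqP => [->|/eqP i0]; case: eqP => [->|/eqP j0] [] ->.
- by rewrite eqxx.
- by move=> /eqP; rewrite eq_sym oner_eq0.
- by move=> /eqP; rewrite oner_eq0.
suff -> : i = j by rewrite eqxx.
apply/val_inj; move: i0 j0; rewrite -!val_eqE.
by case: i => -[|[|//]] ?; case: j => -[|[|//]] ?.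
Qed.

(** The corners of the upper triangle. *)
Definition upper_crossings : seq (('I_3 * R) * ('I_3 * R)) :=
  [:: ((tri0, 0), (tri1, 0)); ((tri0, 1), (tri2, 1)); ((tri1, -1), (tri2, -1))].

Lemma upper_crossing_list :
  crossing_list (@upper_triangle R) (fun _ _ => true) upper_crossings.
Proof.
have h1 : hill (1 : R) = 1 by rewrite /hill; field.
split.
- by apply: (map_uniq (f := fun q => (q.1.1, q.2.1))).
- move=> q; rewrite !inE => /or3P[] /eqP ->;
    split; rewrite /in_range //=;
    first [by rewrite /upper_triangle /= ?hillN ?h1 ?oppr0 ?opprK | lra].
move=> [[i u] [j v]] [/= u2 _ e ne _]; rewrite /in_range /= in u2.
have uv : u = v.
  by move: e; rewrite /upper_triangle; case: i ne => -[|[|[|//]]] ? _;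
    case: j => -[|[|[|//]]] ? /=; case.
rewrite -{v}uv in e ne *.
have I3 (x : 'I_3) : [\/ x = tri0, x = tri1 | x = tri2].
  by case: x => -[|[|[|//]]] x3; [constructor 1 | constructor 2 | constructor 3];
    exact/val_inj.
have u2' : -2 <= - u <= 2 by lra.
have c01 : u = - u -> ((tri0, u), (tri1, u)) \in upper_crossings.
  by move=> h; have -> : u = 0 by [lra]; rewrite !inE eqxx.
have c02 : hill u = u -> ((tri0, u), (tri2, u)) \in upper_crossings.
  by move=> /(hill_fixpoint u2) ->; rewrite !inE eqxx orbT.
have c12 : hill u = - u -> ((tri1, u), (tri2, u)) \in upper_crossings.
  rewrite -hillN => /(hill_fixpoint u2') h.
  by have -> : u = -1 by [lra]; rewrite !inE eqxx !orbT.
have [ei|ei|ei] := I3 i; have [ej|ej|ej] := I3 j; rewrite ei ej in e ne *;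
  rewrite ?eqxx // in ne; case: e => e.
- by left; apply: c01.
- by left; apply: c02.
- by right; apply: c01.
- by left; apply: c12.
- by right; apply: c02.
- by right; apply: c12.
Qed.

(** The effect of the half-turn on the parameters of a crossing. *)
Definition reverse_crossing (q : ('I_3 * R) * ('I_3 * R)) :
    ('I_3 * R) * ('I_3 * R) :=
  ((q.1.1, - q.1.2), (q.2.1, - q.2.2)).

Lemma reverse_crossingK : involutive reverse_crossing.
Proof. by case=> [[i u] [j v]]; rewrite /reverse_crossing /= !opprK. Qed.

Lemma lower_crossing (cl : 'I_3 -> 'I_3 -> bool) q :
  crossing (@lower_triangle R) cl q ->
  crossing (@upper_triangle R) cl (reverse_crossing q).
Proof.
case: q => [[i u] [j v]] [r1 r2 e ne clq]; rewrite /in_range /= in r1 r2 e.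
split; rewrite /in_range //=; [lra | lra | |].
  by apply: oppr_inj; rewrite -!lower_triangleE.
by apply: contra ne => /eqP[-> /oppr_inj ->].
Qed.

Lemma upper_crossing (cl : 'I_3 -> 'I_3 -> bool) q :
  crossing (@upper_triangle R) cl q ->
  crossing (@lower_triangle R) cl (reverse_crossing q).
Proof.
case: q => [[i u] [j v]] [r1 r2 e ne clq]; rewrite /in_range /= in r1 r2 e.
split; rewrite /in_range //=; [lra | lra | |].
  by rewrite !lower_triangleE !opprK e.
by apply: contra ne => /eqP[-> /oppr_inj ->].
Qed.

Lemma lower_crossing_list (cl : 'I_3 -> 'I_3 -> bool) L :
  crossing_list (@upper_triangle R) cl L ->
  crossing_list (@lower_triangle R) cl (map reverse_crossing L).
Proof.
move=> [uL LP H]; split.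
- have -> : map (@flip _) (map reverse_crossing L) =
      map reverse_crossing (map (@flip _) L) by rewrite -!map_comp.
  by rewrite -map_cat map_inj_uniq //; exact: inv_inj reverse_crossingK.
- by move=> q /mapP[q' /LP q'L ->]; exact: upper_crossing.
move=> q /lower_crossing/H[] qL; [left | right].
  by rewrite -[q]reverse_crossingK map_f.
by rewrite -[flip q]reverse_crossingK map_f.
Qed.

Lemma is_derive_upper_fst (i : 'I_3) u :
  is_derive u 1 (fun x => (upper_triangle i x).1) 1.
Proof.
have -> : (fun x : R => (upper_triangle i x).1) = id.
  by apply/funext => x; case: i => -[|[|[|//]]] ?.
exact: is_derive_id.
Qed.

(** The slopes of the strands of the triangle. *)
Definition upper_slope (i : 'I_3) u : R :=
  match val i with
  | 0%N => 1
  | 1%N => -1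
  | _ => - (4 * u * (4 - u ^+ 2)) / 9
  end.

Lemma is_derive_upper_snd (i : 'I_3) u :
  is_derive u 1 (fun x => (upper_triangle i x).2) (upper_slope i u).
Proof.
case: i => -[|[|[|//]]] ?; rewrite /upper_triangle /upper_slope /=.
- exact: is_derive_id.
- by apply: is_derive_eq.
- exact: is_derive_hill.
Qed.

Lemma is_derive_reflect (f : R -> R) u (l : R) : is_derive (- u) 1 f l ->
  is_derive u 1 (fun x => - f (- x)) l.
Proof.
move=> fl; have h : is_derive u 1 (f \o -%R) (l * -1).
  exact: is_derive1_comp.
by have := is_deriveN h; rewrite mulrN1 opprK.
Qed.

Lemma is_derive_lower_fst (i : 'I_3) u :
  is_derive u 1 (fun x => (lower_triangle i x).1) 1.
Proof.
have -> : (fun x : R => (lower_triangle i x).1) =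
    (fun x => - (upper_triangle i (- x)).1).
  by apply/funext => x; rewrite lower_triangleE.
exact: is_derive_reflect (is_derive_upper_fst i _).
Qed.

Lemma is_derive_lower_snd (i : 'I_3) u :
  is_derive u 1 (fun x => (lower_triangle i x).2) (upper_slope i (- u)).
Proof.
have -> : (fun x : R => (lower_triangle i x).2) =
    (fun x => - (upper_triangle i (- x)).2).
  by apply/funext => x; rewrite lower_triangleE.
exact: is_derive_reflect (is_derive_upper_snd i _).
Qed.

Lemma is_derive_bigon_fst (i : 'I_2) u :
  is_derive u 1 (fun x => (bigon i x).1) 1.
Proof.
have -> : (fun x : R => (bigon i x).1) = id.
  by apply/funext => x; rewrite /bigon; case: ifP.
exact: is_derive_id.
Qed.

Lemma is_derive_bigon_snd0 u : is_derive u 1 (fun x => (bigon ord0 x).2) 0.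
Proof. by rewrite /bigon /=; exact: is_derive_cst. Qed.

Lemma is_derive_bigon_snd1 u :
  is_derive u 1 (fun x => (bigon ord_max x).2) (4 * u * (4 - u ^+ 2) / 9).
Proof.
rewrite /bigon /=; have h := is_derive_hill u.
have := is_deriveB (is_derive_cst (1:R) u 1) h.
by rewrite mulNr opprK add0r.
Qed.

End HillAndStrands.

(** * Links with the strands of a move *)

Section Links.
Variables (R : realType) (k : nat) (a b : 'I_k -> R).
Hypothesis abP : forall i, [/\ 0 < a i < 1, 0 < b i < 1 & a i != b i].
Implicit Types (p : 'I_k * R) (c : R * R).

(** An arrow with both ends outside the strands. *)
Definition outside_pair c : Prop :=
  [/\ 0 <= c.1 < 1, 0 <= c.2 < 1, outside a b c.1 & outside a b c.2].

(** From outside, the position of an end of an arrow on its strand is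
    invisible. *)
Lemma link_outside c p p' q q' : outside_pair c ->
  in_range p -> in_range p' -> in_range q -> in_range q' ->
  p.1 = q.1 -> p'.1 = q'.1 ->
  link (spoint a b p, spoint a b p') c = link (spoint a b q, spoint a b q') c /\
  link c (spoint a b p, spoint a b p') = link c (spoint a b q, spoint a b q').
Proof.
case: p p' q q' => [i u] [i' u'] [j v] [j' v'] [c1 c2 o1 o2].
rewrite /in_range /= => u2 u2' v2 v2' ij ij'; subst j j'; rewrite /link /=.
have [e1 f1] := gap_outside abP i c1 o1 u2 v2.
have [e2 f2] := gap_outside abP i c2 o2 u2 v2.
have [e1' f1'] := gap_outside abP i' c1 o1 u2' v2'.
have [e2' f2'] := gap_outside abP i' c2 o2 u2' v2'.
by rewrite e1 f1 e2 f2 e1' f1' e2' f2'.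
Qed.

(** An arrow with both ends on one strand links no arrow outside. *)
Lemma link_outside_kink c p p' : outside_pair c ->
  in_range p -> in_range p' -> p.1 = p'.1 ->
  link (spoint a b p, spoint a b p') c = 0 /\
  link c (spoint a b p, spoint a b p') = 0.
Proof.
move=> oc pr pr' e; have [-> ->] := link_outside oc pr pr' pr' pr' e erefl.
by rewrite /link /=; split; ring.
Qed.

End Links.

(** * Invariance under the moves *)

Section Moves.
Variable R : realType.
Implicit Types (D E : vdiagram R) (n : nat).

(** A kink has an isolated arrow. *)
Lemma RI_dwrithe D E n :
  tangle_move (@box1 R) (@kink R) (@unkink R) (fun _ _ p => p <> Virt) D E ->
  dwrithe n D = dwrithe n E.
Proof.
move=> DE; have [//|a [b [s0 [dDE _ os0 -> ->]]]] :=
  tangle_move_dwrithe (@kink_box R) (@unkink_box R) (kink_crossing_list R)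
    (unkink_crossing_list R) _ n DE.
have [abP dis _ _] := dDE; rewrite /=.
have r1 : in_range (ord0 : 'I_1, 1 : R) by rewrite /in_range /=; lra.
have r2 : in_range (ord0 : 'I_1, -1 : R) by rewrite /in_range /=; lra.
have ne : spoint a b (ord0, 1) != spoint a b (ord0, -1).
  apply/eqP => /(spoint_inj abP dis r1 r2)[] e.
  by have : (1 : R) = -1 by []; lra.
apply: flatwrithe_isolated.
  rewrite /arrow_of /spoints /flip; case: ifP => _;
    by apply: link_self; rewrite //= ?(spoint_unit abP) // eq_sym.
move=> c /os0 oc; rewrite /arrow_of /spoints /flip.
by case: ifP => _; apply: link_outside_kink.
Qed.

(** Moves where all crossings of the strands are virtual. *)
Lemma virtual_dwrithe (k : nat) B (sigma tau : 'I_k -> R -> R * R) L M D E n :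
  (forall i u, -2 <= u <= 2 -> B (sigma i u)) ->
  (forall i u, -2 <= u <= 2 -> B (tau i u)) ->
  crossing_list sigma (fun _ _ => true) L ->
  crossing_list tau (fun _ _ => true) M ->
  tangle_move B sigma tau (@all_virtual k) D E -> dwrithe n D = dwrithe n E.
Proof.
move=> sB tB sL tM DE.
have sL0 := crossing_list_filter (cl := fun _ _ => false) (fun _ _ => erefl) sL.
have tM0 := crossing_list_filter (cl := fun _ _ => false) (fun _ _ => erefl) tM.
have wP (i j : 'I_k) p : all_virtual i j p -> p <> Virt <-> false by move=> ->.
have [a [b [s0 [_ _ _ -> ->]]]] := tangle_move_dwrithe sB tB sL0 tM0 wP n DE.
by rewrite !filter_pred0 /=.
Qed.

Lemma by_height_classical (k : nat) (ht : 'I_k -> nat) i j p :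
  by_height ht i j p -> p <> Virt <-> true.
Proof. by rewrite /by_height => ->; case: ifP. Qed.

(** A bigon has two parallel arrows of opposite directions. *)
Lemma RII_dwrithe D E n (ht : 'I_2 -> nat) :
  tangle_move (@box2 R) (@bigon R) (@unbigon R) (by_height ht) D E ->
  dwrithe n D = dwrithe n E.
Proof.
move=> DE; have [a [b [s0 [dDE _ os0 -> ->]]]] :=
  tangle_move_dwrithe (@bigon_box R) (@unbigon_box R) (bigon_crossing_list R)
    (unbigon_crossing_list R) (@by_height_classical 2 ht) n DE.
have [abP dis _ _] := dDE; rewrite /=.
have r1 (i : 'I_2) : in_range (i, 1 : R) by rewrite /in_range /=; lra.
have r2 (i : 'I_2) : in_range (i, -1 : R) by rewrite /in_range /=; lra.
have inj := spoint_inj abP dis.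
have n1 : (1 == -1 :> R) = false by apply/eqP; lra.
have neP p q : in_range p -> in_range q -> p != q -> spoint a b p != spoint a b q.
  by move=> pr qr; apply: contra => /eqP /(inj _ _ pr qr) ->.
have s1 : -2 < (1 : R) < 2 by lra.
have s2 : -2 < (-1 : R) < 2 by lra.
(* The strands cross with opposite signs at the two corners. *)
set d := (b ord0 - a ord0) * (b ord_max - a ord_max).
have lr1 : left_right D (spoint a b (ord0, 1)) (spoint a b (ord_max, 1)) <-> 0 < d.
  apply: (iff_trans (left_right_spoint (p := (ord0, 1)) (p' := (ord_max, 1))
    dDE s1 s1 (is_derive_bigon_fst ord0 1) (is_derive_bigon_snd0 1)
    (is_derive_bigon_fst ord_max 1) (is_derive_bigon_snd1 1))).
  by rewrite /= -/d pmulr_lgt0 //; lra.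
have lr2 : left_right D (spoint a b (ord0, -1)) (spoint a b (ord_max, -1)) <-> d < 0.
  apply: (iff_trans (left_right_spoint (p := (ord0, -1)) (p' := (ord_max, -1))
    dDE s2 s2 (is_derive_bigon_fst ord0 _) (is_derive_bigon_snd0 _)
    (is_derive_bigon_fst ord_max _) (is_derive_bigon_snd1 _))).
  by rewrite /= -/d nmulr_lgt0 //; lra.
have d0 : d != 0.
  have [_ _ n0] := abP ord0; have [_ _ nm] := abP ord_max.
  by rewrite mulf_neq0 // subr_eq0 eq_sym.
set x1 := spoint a b (ord0, 1); set y1 := spoint a b (ord_max, 1).
set x2 := spoint a b (ord0, -1); set y2 := spoint a b (ord_max, -1).
have opp : link (x1, y1) (x1, y1) = 1 /\ link (x2, y2) (x2, y2) = 1 /\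
    link (x1, y1) (x2, y2) + link (x2, y2) (x1, y1) = 0.
  do !split; [apply: link_self | apply: link_self | apply: link_antisym];
    rewrite /= ?(spoint_unit abP) // neP // xpair_eqE /= ?n1 ?andbF //.
have out c : c \in s0 ->
    link (x1, y1) c = link (x2, y2) c /\ link c (x1, y1) = link c (x2, y2).
  by move=> /os0 oc; apply: (link_outside abP oc).
have [l1 [l2 l12]] := opp.
have [dlt|dgt] := ltP d 0.
  have -> : arrow_of a b D ((ord0, 1), (ord_max, 1)) = (y1, x1).
    by rewrite /arrow_of asboolF //= lr1 lt_gtF.
  have -> : arrow_of a b D ((ord0, -1), (ord_max, -1)) = (x2, y2).
    by rewrite /arrow_of asboolT //= lr2.
  have F := link_flipl (x1, y1); have G e := link_flipr e (x1, y1).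
  apply: flatwrithe_opposite; rewrite /= in F G.
  - by rewrite F G opprK.
  - by [].
  - by rewrite F G -opprD l12 oppr0.
  by move=> c /out[e1 e2]; rewrite F G e1 e2 !addNr.
have dgt' : 0 < d by rewrite lt_neqAle eq_sym d0.
have -> : arrow_of a b D ((ord0, 1), (ord_max, 1)) = (x1, y1).
  by rewrite /arrow_of asboolT //= lr1.
have -> : arrow_of a b D ((ord0, -1), (ord_max, -1)) = (y2, x2).
  by rewrite /arrow_of asboolF //= lr2 lt_gtF.
have F := link_flipl (x2, y2); have G e := link_flipr e (x2, y2).
apply: flatwrithe_opposite; rewrite /= in F G.
- by [].
- by rewrite F G opprK.
- by rewrite F G -opprD l12 oppr0.
by move=> c /out[e1 e2]; rewrite F G e1 e2 !subrr.
Qed.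

(** * The third move *)

Section Triangle.
Variables (D E : vdiagram R) (a b : 'I_3 -> R).
Hypothesis DE : local_change (@box2 R) (@upper_triangle R) (@lower_triangle R)
  a b D E.
Hypothesis ED : local_change (@box2 R) (@lower_triangle R) (@upper_triangle R)
  a b E D.

Let abP i : [/\ 0 < a i < 1, 0 < b i < 1 & a i != b i].
Proof. by case: DE. Qed.

Let dis i j u v : -2 <= u <= 2 -> -2 <= v <= 2 ->
  strand (a i) (b i) u = strand (a j) (b j) v -> i = j.
Proof. by case: DE => _ H _ _; apply: H. Qed.

(** Whether [q.1] is on the left strand at the crossing [q]: the sign of the
    determinant of the two velocities, which takes into account the directions
    of the strands. *)
Definition triangle_sign (q : ('I_3 * R) * ('I_3 * R)) : bool :=
  0 < (b q.1.1 - a q.1.1) * (b q.2.1 - a q.2.1) *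
      (upper_slope q.2.1 q.2.2 - upper_slope q.1.1 q.1.2).

Lemma arrow_of_upper q : -2 < q.1.2 < 2 -> -2 < q.2.2 < 2 ->
  arrow_of a b D q =
  if triangle_sign q then spoints a b q else flip (spoints a b q).
Proof.
move=> r1 r2; rewrite /arrow_of; congr (if _ then _ else _).
apply: asbool_equiv_eqP; first exact: idP.
rewrite /triangle_sign (left_right_spoint DE r1 r2 (is_derive_upper_fst _ _)
  (is_derive_upper_snd _ _) (is_derive_upper_fst _ _) (is_derive_upper_snd _ _)).
by rewrite mul1r mulr1.
Qed.

Lemma arrow_of_lower q : -2 < q.1.2 < 2 -> -2 < q.2.2 < 2 ->
  arrow_of a b E (reverse_crossing q) =
  if triangle_sign q then spoints a b (reverse_crossing q)
  else flip (spoints a b (reverse_crossing q)).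
Proof.
move=> r1 r2; rewrite /arrow_of; congr (if _ then _ else _).
apply: asbool_equiv_eqP; first exact: idP.
rewrite (left_right_spoint ED _ _ (is_derive_lower_fst _ _)
  (is_derive_lower_snd _ _) (is_derive_lower_fst _ _) (is_derive_lower_snd _ _)).
- by rewrite mul1r mulr1 /= !opprK.
- by rewrite /=; lra.
- by rewrite /=; lra.
Qed.

Lemma upper_crossings_interior q : q \in upper_crossings R ->
  -2 < q.1.2 < 2 /\ -2 < q.2.2 < 2.
Proof. by rewrite !inE => /or3P[] /eqP -> /=; split; lra. Qed.

(** A crossing of the triangle keeps its sign, and its ends stay on their
    strands, so nothing changes for the arrows outside. *)
Lemma triangle_outside q c : q \in upper_crossings R -> outside_pair a b c ->
  link (arrow_of a b D q) c = link (arrow_of a b E (reverse_crossing q)) c /\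
  link c (arrow_of a b D q) = link c (arrow_of a b E (reverse_crossing q)).
Proof.
move=> /upper_crossings_interior[r1 r2] oc.
rewrite (arrow_of_upper r1 r2) (arrow_of_lower r1 r2).
have [||||e1 e2] := @link_outside _ _ _ _ abP c q.1 q.2 (reverse_crossing q).1
    (reverse_crossing q).2 oc _ _ _ _ erefl erefl; rewrite /in_range /=; try lra.
case: ifP => _; first by split.
have F := link_flipl (spoints a b q).
have F' := link_flipl (spoints a b (reverse_crossing q)).
rewrite /flip F F'; split; first by congr (- _).
have G e := link_flipr e (spoints a b q).
have G' e := link_flipr e (spoints a b (reverse_crossing q)).
by rewrite G G'; congr (- _).
Qed.

Let t (i : 'I_3) : bool := 0 < b i - a i.
Let x i u := spoint a b (i, u).

Lemma gt0_mul_sign (i j : 'I_3) :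
  (0 < (b i - a i) * (b j - a j)) = (t i == t j) /\
  ((b i - a i) * (b j - a j) < 0) = (t i != t j).
Proof.
have nz h : b h - a h != 0 by have [_ _ ab] := abP h; rewrite subr_eq0 eq_sym.
rewrite /t; move: (b i - a i) (nz i) (b j - a j) (nz j) => y y0 z z0.
have [yn|yp|ye] := ltgtP y 0; last by rewrite ye eqxx in y0.
  rewrite nmulr_rgt0 // nmulr_rlt0 //.
  by have [zn|zp|ze] := ltgtP z 0; last by rewrite ze eqxx in z0.
rewrite pmulr_rgt0 // pmulr_rlt0 //.
by have [zn|zp|ze] := ltgtP z 0; last by rewrite ze eqxx in z0.
Qed.

Lemma triangle_signs :
  [/\ triangle_sign ((tri0, 0), (tri1, 0)) = (t tri0 != t tri1),
      triangle_sign ((tri0, 1), (tri2, 1)) = (t tri0 != t tri2)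
    & triangle_sign ((tri1, -1), (tri2, -1)) = (t tri1 == t tri2)].
Proof.
rewrite /triangle_sign /upper_slope /=; split.
- by rewrite nmulr_lgt0 ?(gt0_mul_sign _ _).2 //; lra.
- by rewrite nmulr_lgt0 ?(gt0_mul_sign _ _).2 //; lra.
- by rewrite pmulr_lgt0 ?(gt0_mul_sign _ _).1 //; lra.
Qed.

(** [t i] tells whether the strand [i] is run through forwards. *)
Lemma gap_on_strand (i : 'I_3) (u v : R) :
  -2 <= u <= 2 -> -2 <= v <= 2 -> u < v ->
  gap (x i u) (x i v) = (t i)%:Z /\ gap (x i v) (x i u) = (~~ t i)%:Z.
Proof.
move=> u2 v2 uv; rewrite /x !(gap_same abP) //.
have nz : b i - a i != 0 by have [_ _ ab] := abP i; rewrite subr_eq0 eq_sym.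
rewrite pmulr_lgt0 ?subr_gt0 // nmulr_lgt0 ?subr_lt0 // /t.
by rewrite subr_gt0 -leNgt le_eqVlt -subr_eq0 (negPf nz).
Qed.

(** On each strand the two crossings are exchanged, which changes the links
    between the three arrows; the signs are such that these changes cancel. *)
Lemma triangle_links : {in upper_crossings R, forall q,
  \sum_(q' <- upper_crossings R) link (arrow_of a b D q) (arrow_of a b D q') =
  \sum_(q' <- upper_crossings R)
    link (arrow_of a b E (reverse_crossing q))
         (arrow_of a b E (reverse_crossing q'))}.
Proof.
have [t01 t02 t12] := triangle_signs.
(* The three points of a strand, at -1, 0 and 1, are tagged Lt, Eq and Gt. *)
pose val (k : comparison) : R := match k with Lt => -1 | Eq => 0 | Gt => 1 end.
have [X [XE Xsame [G [Xcross GC]]]] : exists X : 'I_3 -> comparison -> R,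
    [/\ forall i k, x i (val k) = X i k,
        forall i k l, gap (X i k) (X i l) =
          match k, l with
          | Lt, Eq | Lt, Gt | Eq, Gt => (t i)%:Z
          | Eq, Lt | Gt, Lt | Gt, Eq => (~~ t i)%:Z
          | _, _ => 0
          end
      & exists G : 'I_3 -> 'I_3 -> int,
        (forall i j k l, i != j -> gap (X i k) (X j l) = G i j) /\
        (forall i j, i != j -> G i j + G j i = 1)].
  have v2 k : -2 <= val k <= 2 by case: k => /=; lra.
  exists (fun i k => x i (val k)); split=> // [i k l|].
    have lt01 : (0 : R) < 1 by lra.
    have ltN0 : (-1 : R) < 0 by lra.
    have ltN1 : (-1 : R) < 1 by lra.
    have on := @gap_on_strand i; have self u : gap u u = 0 by rewrite /gap subrr ceil0.
    case: k (v2 k) => v2k; case: l (v2 l) => v2l; rewrite ?self //.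
    - exact: (on _ _ v2l v2k ltN0).2.
    - exact: (on _ _ v2k v2l lt01).1.
    - exact: (on _ _ v2k v2l ltN0).1.
    - exact: (on _ _ v2k v2l ltN1).1.
    - exact: (on _ _ v2l v2k lt01).2.
    - exact: (on _ _ v2l v2k ltN1).2.
  have [G [GE GC]] := gap_cross abP dis; exists G; split=> // i j k l ij.
  exact: GE.
have s0 : -2 < (0 : R) < 2 by lra.
have s1 : -2 < (1 : R) < 2 by lra.
have sN : -2 < (-1 : R) < 2 by lra.
have D01 := arrow_of_upper (q := ((tri0, 0), (tri1, 0))) s0 s0.
have D02 := arrow_of_upper (q := ((tri0, 1), (tri2, 1))) s1 s1.
have D12 := arrow_of_upper (q := ((tri1, -1), (tri2, -1))) sN sN.
have E01 := arrow_of_lower (q := ((tri0, 0), (tri1, 0))) s0 s0.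
have E02 := arrow_of_lower (q := ((tri0, 1), (tri2, 1))) s1 s1.
have E12 := arrow_of_lower (q := ((tri1, -1), (tri2, -1))) sN sN.
have X0 i : spoint a b (i, 0) = X i Eq by rewrite -XE.
have X1 i : spoint a b (i, 1) = X i Gt by rewrite -XE.
have XN i : spoint a b (i, -1) = X i Lt by rewrite -XE.
have XN0 i : spoint a b (i, -0) = X i Eq by rewrite oppr0.
have XNN i : spoint a b (i, - -1) = X i Gt by rewrite opprK.
rewrite t01 /spoints /flip /= in D01 E01.
rewrite t02 /spoints /flip /= in D02 E02.
rewrite t12 /spoints /flip /= in D12 E12.
rewrite !X0 in D01; rewrite !X1 in D02; rewrite !XN in D12.
rewrite !XN0 in E01; rewrite !XN in E02; rewrite !XNN in E12.
have sumE (F : ('I_3 * R) * ('I_3 * R) -> int) :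
    \sum_(q <- upper_crossings R) F q = F ((tri0, 0), (tri1, 0)) +
      (F ((tri0, 1), (tri2, 1)) + F ((tri1, -1), (tri2, -1))).
  by rewrite !big_cons big_nil addr0.
have G01 := GC tri0 tri1 isT; have G02 := GC tri0 tri2 isT.
have G12 := GC tri1 tri2 isT.
have C01 := Xcross tri0 tri1 _ _ isT; have C10 := Xcross tri1 tri0 _ _ isT.
have C02 := Xcross tri0 tri2 _ _ isT; have C20 := Xcross tri2 tri0 _ _ isT.
have C12 := Xcross tri1 tri2 _ _ isT; have C21 := Xcross tri2 tri1 _ _ isT.
move=> q; rewrite !sumE D01 D02 D12 E01 E02 E12 !inE.
case/or3P=> /eqP ->; rewrite ?D01 ?D02 ?D12 ?E01 ?E02 ?E12.
all: case: (t tri0) (Xsame tri0) => S0; case: (t tri1) (Xsame tri1) => S1;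
    case: (t tri2) (Xsame tri2) => S2; rewrite /link /=;
  rewrite ?(S0, S1, S2, C01, C10, C02, C20, C12, C21).
all: move: (G tri0 tri1) (G tri1 tri0) (G tri0 tri2) (G tri2 tri0)
  (G tri1 tri2) (G tri2 tri1) G01 G02 G12 => g01 g10 g02 g20 g12 g21 e01 e02 e12.
all: clear - e01 e02 e12.
all: lia.
Qed.

End Triangle.

Lemma RIII_dwrithe D E n (ht : 'I_3 -> nat) :
  tangle_move (@box2 R) (@upper_triangle R) (@lower_triangle R) (by_height ht)
    D E ->
  dwrithe n D = dwrithe n E.
Proof.
move=> DE; have uL := upper_crossing_list R.
have [a [b [s0 [dDE dED os0 -> ->]]]] :=
  tangle_move_dwrithe (@upper_triangle_box R) (@lower_triangle_box R) uL
    (lower_crossing_list uL) (@by_height_classical 3 ht) n DE.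
have key := flatwrithe_replace n%:Z (f := arrow_of a b D)
  (g := arrow_of a b E \o @reverse_crossing R) _ (triangle_links dDE dED).
apply: etrans (key s0 _) _; last by rewrite (map_comp (arrow_of a b E)).
by move=> q c qL /os0 oc; exact: triangle_outside.
Qed.

(** A virtual strand passing a classical crossing meets no arrow, and the
    classical crossing is the same on both sides. *)
Lemma SV_dwrithe D E n (ht : 'I_3 -> nat) :
  tangle_move (@box2 R) (@upper_triangle R) (@lower_triangle R)
    (fun i j p => if (i == ord_max) || (j == ord_max) then p = Virt
                  else by_height ht i j p) D E ->
  dwrithe n D = dwrithe n E.
Proof.
pose cl : rel 'I_3 := fun i j => ~~ ((i == ord_max) || (j == ord_max)).
have clC : symmetric cl by move=> i j; rewrite /cl orbC.
have uL : crossing_list (@upper_triangle R) cl [:: ((tri0, 0), (tri1, 0))] :=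
  crossing_list_filter clC (upper_crossing_list R).
have wP (i j : 'I_3) p : (if (i == ord_max) || (j == ord_max) then p = Virt
    else by_height ht i j p) -> p <> Virt <-> cl i j.
  by rewrite /cl; case: ifP => _ => [->|/by_height_classical].
move=> DE; have [a [b [s0 [dDE dED _ -> ->]]]] :=
  tangle_move_dwrithe (@upper_triangle_box R) (@lower_triangle_box R) uL
    (lower_crossing_list uL) wP n DE.
have r0 : -2 < (0 : R) < 2 by lra.
have e : arrow_of a b D ((tri0, 0), (tri1, 0)) =
    arrow_of a b E (reverse_crossing ((tri0, 0), (tri1, 0))).
  rewrite (@arrow_of_upper _ _ _ _ dDE ((tri0, 0), (tri1, 0)) r0 r0).
  rewrite (@arrow_of_lower _ _ _ _ dED ((tri0, 0), (tri1, 0)) r0 r0).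
  by rewrite /reverse_crossing /= oppr0.
by rewrite /= e.
Qed.

Lemma vmove_dwrithe D E n : vmove D E -> dwrithe n D = dwrithe n E.
Proof.
case=> [[Phi [rho [P r c p]]]| |ht _|ht _| | | |ht _].
- exact: isotopy_dwrithe P r c p n.
- exact: RI_dwrithe.
- exact: RII_dwrithe.
- exact: RIII_dwrithe.
- exact: (virtual_dwrithe n (@kink_box R) (@unkink_box R)
    (kink_crossing_list R) (unkink_crossing_list R)).
- exact: (virtual_dwrithe n (@bigon_box R) (@unbigon_box R)
    (bigon_crossing_list R) (unbigon_crossing_list R)).
- exact: (virtual_dwrithe n (@upper_triangle_box R) (@lower_triangle_box R)
    (upper_crossing_list R) (lower_crossing_list (upper_crossing_list R))).
- exact: SV_dwrithe.
Qed.

End Moves.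

Theorem lemma2p4 (R : realType) (n : nat) (hn : (0 < n)%N) :
  flat_virtual_knot_invariant (@dwrithe R n).
Proof.
split=> D E; last exact: dwrithe_crossing_change.
by elim=> [D' E' /vmove_dwrithe| |D' E' _ ->|D' F E' _ -> _ ->].
Qed.
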